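(* Let $n,d$ be positive integers with $d$ even and $\Delta_{n,d}\neq\emptyset$, that is, $n\ge 3$ and $d\ge 6$, or $n\ge 4$ and $d\ge 4$. Then there exists a stubborn form $P\in P_{n,d}$.
   Context: $P_{n,d}$ is the cone of real forms of degree $d$ in $n$ variables that are nonnegative on $\mathbb{R}^n$; $\Sigma_{n,d}\subset P_{n,d}$ is the cone of forms that are sums of squares of real forms of degree $d/2$; $\Delta_{n,d}=P_{n,d}\setminus\Sigma_{n,d}$. A nonnegative form $P$ is stubborn if $P^k$ is not a sum of squares for any odd $k\ge 1$. *)

(* Defs.v *)
From mathcomp Require Import all_boot all_order all_algebra.
From mathcomp Require Import classical_sets reals mpoly.

Import Order.TTheory GRing.Theory Num.Theory.
Local Open Scope ring_scope.
Local Open Scope classical_set_scope.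

(* The zero polynomial is [d.-homog] for every [d], so it belongs to both
   cones below. *)
Definition nonneg_forms (R : realType) (n d : nat) : set {mpoly R[n]} :=
  [set P | P \is d.-homog /\ forall v : 'I_n -> R, 0 <= P.@[v]].

(* Homogeneity of [P] is implied by the decomposition when [d] is even; it is
   required separately because [d./2] rounds down when [d] is odd. *)
Definition sos_forms (R : realType) (n d : nat) : set {mpoly R[n]} :=
  [set P | P \is d.-homog /\
     exists2 s : seq {mpoly R[n]},
       all (fun q => q \is (d./2).-homog) s & P = \sum_(q <- s) q ^+ 2].

Definition Delta (R : realType) (n d : nat) : set {mpoly R[n]} :=
  nonneg_forms R n d `\` sos_forms R n d.

Definition stubborn (R : realType) (n d : nat) (P : {mpoly R[n]}) : Prop :=
  nonneg_forms R n d P /\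
  forall k : nat, odd k -> ~ sos_forms R n (d * k) (P ^+ k).

(* Main.v *)
Require Import Defs.
From mathcomp Require Import all_boot all_order all_algebra polyXY ring lra zify.
From mathcomp Require Import boolp classical_sets reals.
From mathcomp Require Import mpoly.
From mathcomp Require Import topology normedtype derive.

(** Two facts are to be proved: outside the two ranges of (n, d) every
nonnegative form is a sum of squares (Hilbert, 1888), and inside them there is
a stubborn form, which then also shows that Delta is not empty.

Hilbert's theorem. Outside the ranges, n <= 2, or d = 2, or (n, d) = (3, 4). A
form in one variable is a monomial, and quadratic forms are handled by
completing the square. The other cases rest on one device: if G is a sum of
squares that is positive away from 0, then F / G attains its minimum eps
([hform_ratio_min]), and F - eps G is nonnegative and has a nontrivial zero. A
binary form with a zero is divisible by the square of a linear form, which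
gives an induction on the degree ([binary_sos]). A ternary quartic with a zero
is, in suitable coordinates, x^2 f + x G + h with f, G, h binary forms of
degrees 2, 3, 4 and 4 f h - G^2 >= 0. If f has a zero, it is a multiple of l^2
with l linear, l divides G, and completing the square leaves a binary quartic.
If f is positive, the device is applied to the discriminant 4 f h - G^2:
removing a multiple of f^2 from h creates a zero of the discriminant, a shift
of x by a linear form moves it to a common zero of G and h, and a linear form l
can be extracted: G = l G1, h = l^2 h1 ([shift_to_zero]). A second application
to (f, G1, h1) extracts l', and what remains, x^2 f + x l l' m + k l^2 l'^2
with k constant, is visibly a sum of squares.

Stubborn forms.  Let S(x, y) = x^4 y^2 + y^4 + x^2 - 3 x^2 y^2, a dehomogenized
Choi-Lam sextic.  It is also what the Choi-Lam quartic becomes at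
(1, x y, x, y), so multiples of these two forms by a power of a variable are
stubborn as soon as no odd power of S is a sum of squares of polynomials
([choi_lam_power_not_sos]).  Suppose S^k is the sum of the q^2.  The claim is
that S divides every q; then S^2 cancels, and descending to k = 1 contradicts
S(1, 1) = 0.  To prove the claim, split q into its four parity parts
x^a y^b r(x^2, y^2), and write S = m(x^2, y^2).  The curve m = 0 is a nodal
cubic with an isolated real node at (1, 1), parametrized by X = s^2 / (s - 1),
Y = s (1 - s), the node corresponding to the roots of s^2 - s + 1.  Since m^k is
the sum of the X^a Y^b r^2, each r vanishes to order k at the node, so its
pullback to the curve vanishes to order k at both roots, that is 2 k times.  On
the other hand the Newton polygon of q is contained in k / 2 times that of S
([sos_below]), and this leaves the pullback of r room for at most 3 k / 2 zeros
outside s = 0, 1.  Hence r vanishes on the curve and m divides r. *)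

Set Implicit Arguments.
Unset Strict Implicit.
Unset Printing Implicit Defensive.

Import Order.TTheory GRing.Theory Num.Theory.
Import numFieldNormedType.Exports.
Local Open Scope classical_set_scope.

(** * Forms as functions *)

Section Forms.
Local Open Scope ring_scope.
Variable R : realType.

Lemma poly_nat_roots (p : {poly R}) : (forall n : nat, p.[n%:R] = 0) -> p = 0.
Proof.
move=> p0; apply/eqP; apply/negPn/negP => pn0.
pose s := [seq (i%:R : R) | i <- iota 0 (size p)].
have us : uniq s.
  by rewrite map_inj_uniq ?iota_uniq // => i j /eqP; rewrite eqr_nat => /eqP.
have rs : all (root p) s by apply/allP => _ /mapP [i _ ->]; apply/rootP.
by have := max_poly_roots pn0 rs us; rewrite size_map size_iota ltnn.
Qed.

Lemma poly_ext (p q : {poly R}) : (forall x, p.[x] = q.[x]) -> p = q.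
Proof.
move=> pq; apply/eqP; rewrite -subr_eq0; apply/eqP/poly_nat_roots => n.
by rewrite hornerD hornerN pq subrr.
Qed.

Definition fcons n (x : R) (w : 'I_n -> R) : 'I_n.+1 -> R :=
  fun i => oapp w x (unlift ord0 i).

Lemma fcons0 n x (w : 'I_n -> R) : fcons x w ord0 = x.
Proof. by rewrite /fcons unlift_none. Qed.

Lemma fconsS n x (w : 'I_n -> R) j : fcons x w (lift ord0 j) = w j.
Proof. by rewrite /fcons liftK. Qed.

Lemma fcons_eta n (v : 'I_n.+1 -> R) :
  v = fcons (v ord0) (fun j => v (lift ord0 j)).
Proof.
apply: funext => i; case: (unliftP ord0 i) => [j ->|->].
  by rewrite fconsS.
by rewrite fcons0.
Qed.

(** The coefficient of the i-th power of the first variable. *)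
Definition head_coef n (Q : {mpoly R[n.+1]}) i : {mpoly R[n]} :=
  \sum_(m <- msupp Q | m ord0 == i)
   Q@_m *: 'X_[[multinom m (lift ord0 j) | j < n]].

Lemma meval_fcons n (Q : {mpoly R[n.+1]}) N x w :
    (forall m, m \in msupp Q -> (m ord0 < N)%N) ->
  Q.@[fcons x w] = \sum_(i < N) x ^+ i * (head_coef Q i).@[w].
Proof.
move=> ltN; rewrite mevalE.
rewrite (eq_bigr (fun i : 'I_N => \sum_(m <- msupp Q | m ord0 == i)
     x ^+ i * (Q@_m * \prod_(j < n) w j ^+ m (lift ord0 j)))); last first.
  move=> i _; rewrite -big_distrr /=; congr (_ * _); rewrite raddf_sum.
  apply: eq_bigr => m _ /=; rewrite mevalZ mevalX; congr (_ * _).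
  by apply: eq_bigr => j _; rewrite mnmE.
rewrite (exchange_big_dep xpredT) //=; apply: eq_big_seq => m mQ.
rewrite (big_pred1 (Ordinal (ltN m mQ))); last by move=> i; rewrite eq_sym.
rewrite big_ord_recl fcons0 /= mulrCA; congr (_ * (_ * _)).
by apply: eq_bigr => j _; rewrite fconsS.
Qed.

Lemma mcoeff_head_coef n (Q : {mpoly R[n.+1]}) (m : 'X_{1..n.+1}) :
  (head_coef Q (m ord0))@_[multinom m (lift ord0 j) | j < n] = Q@_m.
Proof.
rewrite raddf_sum /=.
have [mQ|mQ] := boolP (m \in msupp Q); last first.
  move: (mQ); rewrite mcoeff_msupp negbK => /eqP ->.
  rewrite big1_seq // => m' /andP [/eqP e m'Q].
  rewrite mcoeffZ mcoeffX; case: eqP => [h|]; last by rewrite mulr0.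
  suff mm : m = m' by rewrite mm m'Q in mQ.
  apply/mnmP => i; case: (unliftP ord0 i) => [j ->|->] //.
  by move/mnmP/(_ j): h; rewrite !mnmE.
rewrite -big_filter (bigD1_seq m) ?mem_filter ?eqxx ?filter_uniq //=.
rewrite mcoeffZ mcoeffX eqxx mulr1 big_filter_cond big1 ?addr0 //.
move=> m' /andP [/eqP e ne].
rewrite mcoeffZ mcoeffX; case: eqP => [h|]; last by rewrite mulr0.
case/eqP: ne; apply/mnmP => i; case: (unliftP ord0 i) => [j ->|->] //.
by move/mnmP/(_ j): h; rewrite !mnmE.
Qed.

(** A real polynomial is determined by its values: peeling off the first
variable reduces this to the univariate case, where a nonzero polynomial has
finitely many roots. *)
Lemma mpoly_ext n (P Q : {mpoly R[n]}) : (forall v, P.@[v] = Q.@[v]) -> P = Q.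
Proof.
move=> PQ; apply/eqP; rewrite -subr_eq0; apply/eqP.
have : forall v, (P - Q).@[v] = 0 by move=> v; rewrite mevalB PQ subrr.
move: (P - Q) => {P PQ}Q; elim: n Q => [|n IH] Q Q0.
  have QE : Q = (Q@_0%MM)%:MP.
    apply/mpolyP => m; have -> : m = 0%MM by apply/mnmP => -[].
    by rewrite mcoeffC eqxx mulr1.
  by move: (Q0 (fun=> 0)); rewrite QE mevalC => ->; rewrite mpolyC0.
have ltN i m : m \in msupp Q -> (m ord0 < (msize Q + i).+1)%N.
  move=> /msize_mdeg_lt /ltnW; rewrite mdegE big_ord_recl ltnS => h.
  by apply: leq_trans (leq_addr _ _) (leq_trans h (leq_addr _ _)).
apply/mpolyP => m; rewrite mcoeff0 -mcoeff_head_coef; set i := m ord0.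
suff -> : head_coef Q i = 0 by rewrite mcoeff0.
apply: IH => w; have p0 : \poly_(j < (msize Q + i).+1) (head_coef Q j).@[w] = 0.
  apply: poly_ext => x; rewrite horner0 horner_poly.
  apply: etrans (Q0 (fcons x w)); rewrite (meval_fcons _ _ (ltN i)).
  by apply: eq_bigr => j _; rewrite mulrC.
move: (coef_poly (msize Q + i).+1 (fun i => (head_coef Q i).@[w]) i).
by rewrite p0 coef0 ltnS leq_addl.
Qed.

(** Working with the functions rather than with the polynomials makes linear
changes of variables and restrictions to a line plain compositions. *)
Definition hform n d (F : ('I_n -> R) -> R) : Prop :=
  exists2 P : {mpoly R[n]}, P \is d.-homog & forall v, F v = P.@[v].

Lemma hform_const n c : hform 0 (fun _ : 'I_n -> R => c).
Proof.
exists c%:MP => [|v]; last by rewrite mevalC.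
rewrite -[_%:MP]mulr1 mul_mpolyC; apply: rpredZ; exact: dhomog1.
Qed.

Lemma hform_zero n d : hform d (fun _ : 'I_n -> R => 0).
Proof. by exists 0 => [|v]; rewrite ?meval0 ?rpred0. Qed.

Lemma hform_coord n i : hform 1 (fun v : 'I_n -> R => v i).
Proof.
exists 'X_i => [|v]; last by rewrite mevalXU.
by rewrite dhomogX /= mdeg1.
Qed.

Lemma hformD n d (F G : ('I_n -> R) -> R) :
  hform d F -> hform d G -> hform d (fun v => F v + G v).
Proof.
move=> [P hP FP] [Q hQ GQ]; exists (P + Q); first exact: rpredD.
by move=> v; rewrite mevalD FP GQ.
Qed.

Lemma hformM n d e (F G : ('I_n -> R) -> R) :
  hform d F -> hform e G -> hform (d + e) (fun v => F v * G v).
Proof.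
move=> [P hP FP] [Q hQ GQ]; exists (P * Q); first exact: dhomogM.
by move=> v; rewrite mevalM FP GQ.
Qed.

Lemma hformZ n d c (F : ('I_n -> R) -> R) :
  hform d F -> hform d (fun v => c * F v).
Proof. by move=> fF; rewrite -(add0n d); apply: hformM => //; apply: hform_const. Qed.

Lemma hformB n d (F G : ('I_n -> R) -> R) :
  hform d F -> hform d G -> hform d (fun v => F v - G v).
Proof.
move=> fF /(hformZ (-1)) fG; have := hformD fF fG; congr hform.
by apply: funext => v; rewrite mulN1r.
Qed.

Lemma hformX n d k (F : ('I_n -> R) -> R) :
  hform d F -> hform (d * k) (fun v => F v ^+ k).
Proof.
move=> [P hP FP]; exists (P ^+ k); first exact: dhomogMn.
by move=> v; rewrite rmorphXn /= FP.
Qed.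

Lemma hform_sum n d (I : Type) (r : seq I) (F : I -> ('I_n -> R) -> R) :
  (forall i, hform d (F i)) -> hform d (fun v => \sum_(i <- r) F i v).
Proof.
move=> fF; elim: r => [|i r IH].
  by have := hform_zero n d; congr hform; apply: funext => v; rewrite big_nil.
have := hformD (fF i) IH; congr hform.
by apply: funext => v; rewrite big_cons.
Qed.

Lemma hform_comp n m d (F : ('I_n -> R) -> R) (l : 'I_n -> ('I_m -> R) -> R) :
    hform d F -> (forall i, hform 1 (l i)) ->
  hform d (fun v => F (fun i => l i v)).
Proof.
move=> [P hP FP] fl.
have /choice [L hL] : forall i, exists Q : {mpoly R[m]},
    Q \is 1.-homog /\ forall v, l i v = Q.@[v].
  by move=> i; have [Q h1 h2] := fl i; exists Q.
exists (P \mPo [tuple L i | i < n]) => [|v]; last first.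
  rewrite FP comp_mpoly_meval; apply: meval_eq => i.
  by rewrite tnth_mktuple (hL i).2.
rewrite comp_mpolyEX big_seq; apply: rpred_sum => mm mP; apply: rpredZ.
have <- : mdeg mm = d by apply: (dhomog_mf hP).
rewrite comp_mpolyX mdegE.
apply: (big_ind2 (fun (p : {mpoly R[m]}) (e : nat) => p \is e.-homog)).
- exact: dhomog1.
- by move=> p1 e1 p2 e2; exact: dhomogM.
move=> i _; rewrite tnth_mktuple -[X in X.-homog]mul1n; apply: dhomogMn.
by have [] := hL i.
Qed.

Lemma hformZv n d (F : ('I_n -> R) -> R) t v :
  hform d F -> F (fun i => t * v i) = t ^+ d * F v.
Proof.
move=> [P hP FP]; rewrite !FP !mevalE big_distrr /=; apply: eq_big_seq => m mP.
have <- : mdeg m = d by apply: (dhomog_mf hP).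
rewrite mulrCA; congr (_ * _); rewrite mdegE expr_sum -big_split.
by apply: eq_bigr => i _; rewrite exprMn.
Qed.

Lemma hform_line n d (F : ('I_n -> R) -> R) v w : hform d F ->
  exists p : {poly R}, forall t, F (fun i => v i + t * w i) = p.[t].
Proof.
move=> [P _ FP].
exists (\sum_(m <- msupp P) (P@_m)%:P *
   \prod_i ((v i)%:P + 'X * (w i)%:P) ^+ m i) => t.
rewrite FP mevalE horner_sum; apply: eq_bigr => m _.
rewrite hornerM hornerC horner_prod; congr (_ * _); apply: eq_bigr => i _.
by rewrite horner_exp !hornerE.
Qed.

Lemma hform_cons n d (F : ('I_n.+1 -> R) -> R) : hform d F ->
  exists2 B : nat -> ('I_n -> R) -> R,
    (forall i, (i <= d)%N -> hform (d - i) (B i)) &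
    forall x w, F (fcons x w) = \sum_(i < d.+1) x ^+ i * B i w.
Proof.
move=> [P hP FP]; exists (fun i w => (head_coef P i).@[w]).
  move=> i led; exists (head_coef P i) => //.
  rewrite /head_coef big_seq_cond; apply: rpred_sum => m /andP [mP /eqP mi].
  have md : (m ord0 + mdeg [multinom m (lift ord0 j) | j < n])%N = d.
    have <- : mdeg m = d by apply: (dhomog_mf hP).
    rewrite !mdegE big_ord_recl; congr (_ + _)%N.
    by apply: eq_bigr => j _; rewrite mnmE.
  by apply: rpredZ; rewrite dhomogX /= -md mi addKn.
move=> x w; rewrite FP; apply: meval_fcons => m mP.
have <- : mdeg m = d by apply: (dhomog_mf hP).
rewrite ltnS mdegE big_ord_recl.
exact: leq_addr.
Qed.

End Forms.

(** * Ratios of forms attain their minimum *)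

Section Minimum.
Local Open Scope ring_scope.
Variable R : realType.

(** Polynomial functions are continuous for the topology of row vectors, the
one in which closed bounded sets are compact. *)
Lemma hform_continuous n d (F : ('I_n -> R) -> R) : hform d F ->
  continuous (fun u : 'rV[R]_n => F (u ord0)).
Proof.
move=> [P _ FP].
have -> : (fun u : 'rV[R]_n => F (u ord0)) =
    (fun u : 'rV[R]_n => \sum_(m <- msupp P) P@_m * \prod_i u ord0 i ^+ m i).
  by apply: funext => u; rewrite FP mevalE.
move=> u; elim: (msupp P) => [|m s IH].
  rewrite (_ : (fun _ => _) = (fun=> 0)); first exact: cst_continuous.
  by apply: funext => w; rewrite big_nil.
rewrite (_ : (fun _ => _) = (fun w : 'rV[R]_n => P@_m * \prod_i w ord0 i ^+ m i) \+
  (fun w : 'rV[R]_n => \sum_(m <- s) P@_m * \prod_i w ord0 i ^+ m i)); last first.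
  by apply: funext => w /=; rewrite big_cons.
apply: continuousD => //; apply: continuousM; first exact: cst_continuous.
elim: (index_enum _) => [|i r IHr].
  rewrite (_ : (fun _ => _) = (fun=> 1)); first exact: cst_continuous.
  by apply: funext => w; rewrite big_nil.
rewrite (_ : (fun _ => _) = (fun w : 'rV[R]_n => ('X^(m i)).[w ord0 i]) \*
  (fun w : 'rV[R]_n => \prod_(i <- r) w ord0 i ^+ m i)); last first.
  by apply: funext => w /=; rewrite big_cons hornerXn.
apply: continuousM => //.
apply: (@continuous_comp _ _ _ (fun w : 'rV[R]_n => w ord0 i) (horner 'X^(m i))).
  exact: coord_continuous.
exact: continuous_horner.
Qed.

(** By homogeneity it is enough to minimise F / G on the unit sphere, which is
compact. The conclusion is stated without division, so that it also makes sense
at the origin. *)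
Lemma hform_ratio_min n d (F G : ('I_n.+1 -> R) -> R) :
    hform d F -> hform d G ->
    (forall v, (exists i, v i != 0) -> 0 < G v) ->
  exists2 v0, exists i, v0 i != 0 & forall v, F v0 * G v <= F v * G v0.
Proof.
move=> fF fG Gpos.
pose A : set 'rV[R]_n.+1 := [set u | `|u| = 1].
have nzA (u : 'rV[R]_n.+1) : u != 0 -> exists i, u ord0 i != 0.
  move=> un0; apply: contrapT => h; case/eqP: un0; apply/rowP => i.
  by rewrite mxE; apply/eqP/negPn/negP => ui; apply: h; exists i.
have A_nz u : A u -> exists i, u ord0 i != 0.
  by move=> Au; apply: nzA; rewrite -normr_gt0 Au.
have cA : compact A.
  apply: bounded_closed_compact.
    exists 1; split; first exact: num_real.
    by move=> M M1 u /= ->; exact: ltW.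
  have -> : A = (fun u : 'rV[R]_n.+1 => `|u|) @^-1` [set 1] by [].
  by apply: closed_comp => [u _|]; [exact: norm_continuous|exact: closed_eq].
have A0 : A !=set0.
  exists (`|const_mx 1 : 'rV[R]_n.+1|^-1 *: const_mx 1) => /=.
  have n0 : `|const_mx 1 : 'rV[R]_n.+1| != 0.
    rewrite normr_eq0; apply/eqP => /rowP /(_ ord0); rewrite !mxE => /eqP.
    by rewrite oner_eq0.
  by rewrite /A /= normrZ normfV normr_id mulVf.
have cont : {within A, continuous (fun u : 'rV[R]_n.+1 => F (u ord0) / G (u ord0))}.
  apply: continuous_in_subspaceT => u /set_mem uA.
  have Gu : G (u ord0) != 0 by rewrite gt_eqF // Gpos //; exact: A_nz.
  apply: (@continuousM R _ (fun u : 'rV[R]_n.+1 => F (u ord0)) (fun u => (G (u ord0))^-1) u).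
    exact: (hform_continuous fF).
  by apply: continuousV => //; exact: (hform_continuous fG).
have [c /set_mem cA1 cmin] := EVT_min_rV A0 cA cont.
exists (c ord0); first exact: A_nz.
move=> v; have [[i vi]|v0] := pselect (exists i, v i != 0); last first.
  have vE : v = (fun i => 0 * c ord0 i).
    apply: funext => i; rewrite mul0r; apply/eqP/negPn/negP => vi.
    by apply: v0; exists i.
  rewrite vE (hformZv _ _ fF) (hformZv _ _ fG).
  by rewrite mulrCA mulrA.
pose u : 'rV[R]_n.+1 := \row_i v i.
have un0 : `|u| != 0.
  rewrite normr_eq0; apply/eqP => /rowP /(_ i); rewrite !mxE => /eqP.
  by rewrite (negbTE vi).
have uA : A (`|u|^-1 *: u) by rewrite /A /= normrZ normfV normr_id mulVf.
have := cmin _ (mem_set uA).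
have -> : (`|u|^-1 *: u) ord0 = (fun i => `|u|^-1 * v i).
  by apply: funext => j; rewrite !mxE.
rewrite (hformZv _ _ fF) (hformZv _ _ fG) -mulf_div divff ?mul1r; last first.
  by rewrite expf_neq0 // invr_neq0.
rewrite ler_pdivlMr ?Gpos //; last by exists i.
by rewrite mulrAC ler_pdivrMr ?Gpos //; exact: A_nz.
Qed.

End Minimum.

(** * Sums of squares and quadratic forms *)

Section Binary.
Local Open Scope ring_scope.
Variable R : realType.

Lemma poly_ge0_at0 (p : {poly R}) :
  (forall t, 0 < t -> 0 <= p.[t]) -> 0 <= p.[0].
Proof.
move=> pge0; rewrite leNgt; apply/negP => plt0.
have : \forall t \near (0 : R), p.[t] < 0.
  have c : horner p @ (0 : R) --> p.[0] := @continuous_horner R p 0.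
  exact: cvgr_lt c _ plt0.
move=> /nbhs_ballP [e /= e0 H].
have e2 : 0 < e / 2 by rewrite divr_gt0.
have := H (e / 2); rewrite /ball /= sub0r normrN gtr0_norm // ltr_pdivrMr //.
by rewrite ltr_pMr // ltr1n => /(_ isT); rewrite ltNge pge0.
Qed.

(** p is nonnegative to the right of 0 and nonpositive to the left. *)
Lemma poly_sign_root (p : {poly R}) :
  (forall t, 0 <= t * p.[t]) -> p.[0] = 0.
Proof.
move=> tp; apply/eqP; rewrite eq_le; apply/andP; split; last first.
  by apply: poly_ge0_at0 => t t0; rewrite -(pmulr_rge0 _ t0).
have -> : p.[0] = (p \Po (- 'X)).[0] by rewrite horner_comp !hornerE oppr0.
rewrite -oppr_ge0 -hornerN; apply: poly_ge0_at0 => t t0.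
rewrite hornerN horner_comp !hornerE -(pmulr_rge0 _ t0).
by rewrite mulrN -mulNr; exact: tp.
Qed.

Lemma quadratic_ge0 (a b c : R) : (forall x, 0 <= x ^+ 2 * a + x * b + c) ->
  [/\ 0 <= a, 0 <= c & 0 <= 4 * a * c - b ^+ 2].
Proof.
move=> H; have c0 : 0 <= c by have := H 0; rewrite expr0n /= !mul0r !add0r.
have a0 : 0 <= a.
  rewrite leNgt; apply/negP => a0.
  (* at x = 1 + t, x^2 a <= x a = a - c - 1 < - c; adding the values at x and
     - x cancels the linear term *)
  pose t := (c + 1) / - a; have ta : t * - a = c + 1 by rewrite divfK ?oppr_eq0 ?lt_eqF.
  have t0 : 0 <= t by rewrite divr_ge0 ?oppr_ge0 ?ltW //; lra.
  have := H (1 + t); have := H (- (1 + t)); nra.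
split => //; have [a00|a00] := eqVneq a 0.
  subst a; have [->|b0] := eqVneq b 0; first by rewrite mulr0 mul0r expr0n subr0.
  have := H (- (c + 1) / b); rewrite mulr0 add0r divfK //; lra.
have ap : 0 < a by rewrite lt_def a00.
have := H (- b / (2 * a)).
have -> : (- b / (2 * a)) ^+ 2 * a + - b / (2 * a) * b + c =
   (4 * a * c - b ^+ 2) / (4 * a) by field.
by rewrite pmulr_lge0 // invr_gt0 mulr_gt0.
Qed.

(** Sums of squares of functions taken from the class C; C is a parameter so
that one definition serves binary, ternary and general forms of any degree. *)
Inductive sos T (C : (T -> R) -> Prop) : (T -> R) -> Prop :=
  | sos_zero : sos C (fun=> 0)
  | sos_cons q F : C q -> sos C F -> sos C (fun v => q v ^+ 2 + F v).

Lemma sos_ext T C (F G : T -> R) : sos C F -> (forall v, F v = G v) -> sos C G.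
Proof. by move=> sF FG; have <- : F = G by apply: funext. Qed.

Lemma sos_sqr T C (q : T -> R) : C q -> sos C (fun v => q v ^+ 2).
Proof.
by move=> Cq; apply: sos_ext (sos_cons Cq (sos_zero C)) _ => v; rewrite addr0.
Qed.

Lemma sosD T C (F G : T -> R) : sos C F -> sos C G -> sos C (fun v => F v + G v).
Proof.
move=> sF sG; elim: sF => [|q {}F Cq _ IH].
  by apply: sos_ext sG _ => v; rewrite add0r.
by apply: sos_ext (sos_cons Cq IH) _ => v; rewrite addrA.
Qed.

(** The common source of closure under multiplication by a square and under
substitution. *)
Lemma sos_pull T T' C C' (m : T' -> R) (g : T' -> T) (F : T -> R) :
    (forall q, C q -> C' (fun v => m v * q (g v))) ->
  sos C F -> sos C' (fun v => m v ^+ 2 * F (g v)).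
Proof.
move=> CC'; elim=> [|q {}F Cq _ IH].
  by apply: sos_ext (sos_zero C') _ => v; rewrite mulr0.
apply: sos_ext (sos_cons (CC' q Cq) IH) _ => v.
by rewrite mulrDr exprMn.
Qed.

Lemma sosZ n d c (F : ('I_n -> R) -> R) : 0 <= c ->
  sos (hform d) F -> sos (hform d) (fun v => c * F v).
Proof.
move=> c0 sF; have := @sos_pull _ _ _ (hform d) (fun=> Num.sqrt c) id _ _ sF.
move=> /(_ (fun q fq => hformZ _ fq)) /sos_ext; apply => v.
by rewrite sqr_sqrtr.
Qed.

Lemma sos_mpoly n d (F : ('I_n -> R) -> R) : sos (hform d) F ->
  exists2 s : seq {mpoly R[n]}, all (fun q => q \is d.-homog) s &
    forall v, F v = (\sum_(q <- s) q ^+ 2).@[v].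
Proof.
elim=> [|q {}F [Q hQ qQ] _ [s hs Fs]].
  by exists [::] => // v; rewrite big_nil meval0.
exists (Q :: s) => [|v]; first by rewrite /= hQ.
by rewrite big_cons mevalD rmorphXn /= -qQ Fs.
Qed.

Lemma hform_at0 n d (F : ('I_n -> R) -> R) : hform d.+1 F -> F (fun=> 0) = 0.
Proof.
move=> fF; have := hformZv 0 (fun=> 0) fF; rewrite expr0n [RHS]mul0r => e.
rewrite -[RHS]e; congr F; by apply: funext => i; rewrite mul0r.
Qed.

Lemma hform0_const n (F : ('I_n -> R) -> R) v : hform 0 F -> F v = F (fun=> 0).
Proof.
move=> fF; have := hformZv 0 v fF; rewrite expr0 [RHS]mul1r => e.
rewrite -e; congr F; by apply: funext => i; rewrite mul0r.
Qed.

Lemma unary_sos k (F : ('I_1 -> R) -> R) :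
  hform k.*2 F -> (forall v, 0 <= F v) -> sos (hform k) F.
Proof.
move=> fF Fge0; apply: (@sos_ext _ _ (fun v => (Num.sqrt (F (fun=> 1)) * v ord0 ^+ k) ^+ 2)).
  apply/sos_sqr/hformZ; rewrite -[X in hform X]mul1n; apply: hformX.
  exact: hform_coord.
move=> v; rewrite exprMn sqr_sqrtr // -exprM muln2 mulrC -(hformZv _ _ fF).
by congr F; apply: funext => i; rewrite (ord1 i) mulr1.
Qed.

(** Induction on the number of variables: F = a x^2 + x B1 + B0 with B1 and B0
forms in the remaining variables. If a = 0, nonnegativity forces B1 = 0;
otherwise completing the square leaves B0 - B1^2 / (4 a), which is
nonnegative. *)
Lemma quadratic_form_sos n (F : ('I_n -> R) -> R) :
  hform 2 F -> (forall v, 0 <= F v) -> sos (hform 1) F.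
Proof.
elim: n F => [|n IH] F fF Fge0.
  apply: sos_ext (sos_zero _) _ => v; rewrite -(hform_at0 fF).
  by congr F; apply: funext => -[].
have [B fB FB] := hform_cons fF.
set a := B 2%N (fun=> 0).
have FE x w : F (fcons x w) = x ^+ 2 * a + x * B 1%N w + B 0%N w.
  rewrite FB !big_ord_recr big_ord0 /= add0r expr0 mul1r expr1.
  rewrite (hform0_const w (fB 2%N _)) // -/a. ring.
have lift_form d (q : ('I_n -> R) -> R) : hform d q ->
    hform d (fun v : 'I_n.+1 -> R => 1 * q (fun j => v (lift ord0 j))).
  by move=> fq; apply/hformZ/(hform_comp fq) => i; exact: hform_coord.
have H w : [/\ 0 <= a, 0 <= B 0%N w & 0 <= 4 * a * B 0%N w - B 1%N w ^+ 2].
  by apply: quadratic_ge0 => x; rewrite -FE.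
have [a0 _ _] := H (fun=> 0).
have [a00|an0] := eqVneq a 0.
  have B1 w : B 1%N w = 0.
    have [_ _] := H w; rewrite a00 mulr0 mul0r sub0r oppr_ge0.
    by move=> B1le; apply/eqP; rewrite -sqrf_eq0 eq_le B1le sqr_ge0.
  have sB : sos (hform 1) (B 0%N).
    by apply: IH; [exact: (fB 0%N)|move=> w; have [] := H w].
  apply: sos_ext (sos_pull (lift_form 1%N) sB) _ => v.
  by rewrite [in RHS](fcons_eta v) FE a00 B1 !mulr0 !add0r expr1n mul1r.
have ap : 0 < a by rewrite lt_def an0.
have sB : sos (hform 1) (fun w => B 0%N w - (4 * a)^-1 * B 1%N w ^+ 2).
  apply: IH.
    apply: hformB; first exact: (fB 0%N).
    by apply/hformZ/(@hformX _ _ 1 2)/(fB 1%N).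
  move=> w; have [_ _ Dw] := H w.
  have -> : B 0%N w - (4 * a)^-1 * B 1%N w ^+ 2 =
      (4 * a * B 0%N w - B 1%N w ^+ 2) / (4 * a) by field.
  by rewrite divr_ge0 // mulr_ge0.
pose q (v : 'I_n.+1 -> R) := Num.sqrt a * v ord0 +
  (2 * Num.sqrt a)^-1 * (1 * B 1%N (fun j => v (lift ord0 j))).
have fq : hform 1 q.
  apply: hformD; first exact/hformZ/hform_coord.
  by apply/hformZ/lift_form/(fB 1%N).
apply: sos_ext (sosD (sos_sqr fq) (sos_pull (lift_form 1%N) sB)) _.
move=> v; rewrite /q [in RHS](fcons_eta v) FE expr1n mul1r.
have s0 : Num.sqrt a != 0 by rewrite gt_eqF // sqrtr_gt0.
have sa : Num.sqrt a ^+ 2 = a by rewrite sqr_sqrtr.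
set s := Num.sqrt a in s0 sa *; rewrite -sa.
by field.
Qed.

End Binary.

(** * Binary forms *)

Section Binary.
Local Open Scope ring_scope.
Variable R : realType.
Implicit Types (u w : 'I_2 -> R).

Notation i0 := (@ord0 1).
Notation i1 := (lift (@ord0 1) (@ord0 0)).

Definition vec2 (x y : R) : 'I_2 -> R := fcons x (fun=> y).
Definition perp u := vec2 (- u i1) (u i0).
Definition dot u w : R := u i0 * w i0 + u i1 * w i1.
(** As a function of w, the linear form vanishing on the line spanned by u. *)
Definition wedge u w : R := u i0 * w i1 - u i1 * w i0.

Lemma vec2_0 x y : vec2 x y i0 = x. Proof. exact: fcons0. Qed.
Lemma vec2_1 x y : vec2 x y i1 = y. Proof. exact: fconsS. Qed.

Lemma dot_gt0 u : (exists i, u i != 0) -> 0 < dot u u.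
Proof.
case=> i; rewrite /dot -!expr2; case: (unliftP ord0 i) => [j ->|->].
  by rewrite (ord1 j) => ui; rewrite ltr_wpDl ?sqr_ge0 // exprn_even_gt0.
by move=> ui; rewrite ltr_pwDl ?sqr_ge0 // exprn_even_gt0.
Qed.

Lemma hform_dot u : hform 1 (dot u).
Proof. by apply: hformD; apply/hformZ/hform_coord. Qed.

Lemma hform_wedge u : hform 1 (wedge u).
Proof. by apply: hformB; apply/hformZ/hform_coord. Qed.

Lemma wedge_line u w t : wedge u w = 0 ->
  wedge u (fun i => w i + t * perp u i) = t * dot u u.
Proof.
rewrite /wedge /dot /perp vec2_0 vec2_1 => h.
transitivity ((u i0 * w i1 - u i1 * w i0) + t * (u i0 * u i0 + u i1 * u i1)).
  by ring.
by rewrite h add0r.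
Qed.

(** In the orthogonal coordinates given by u and [perp u], the coefficient of
the pure power of the first coordinate is g u, so that the second coordinate,
which is [wedge u] up to a factor, divides g when g u = 0. *)
Lemma form_div_wedge d (g : ('I_2 -> R) -> R) u : hform d.+1 g ->
    (exists i, u i != 0) -> g u = 0 ->
  exists2 g1, hform d g1 & forall w, g w = wedge u w * g1 w.
Proof.
move=> fg un0 gu; have N0 := dot_gt0 un0; set N := dot u u in N0.
have Nn0 : N != 0 by rewrite gt_eqF.
pose rot w : 'I_2 -> R := fun i => w i0 * u i + w i1 * perp u i.
have frot : hform d.+1 (fun w => g (rot w)).
  apply: (hform_comp (l := fun i w => rot w i) fg) => i.
  have := hformD (hformZ (u i) (hform_coord R i0)) (hformZ (perp u i) (hform_coord R i1)).
  by congr hform; apply: funext => w; rewrite /rot mulrC [in X in _ + X]mulrC.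
have [B fB gB] := hform_cons frot.
pose b i := B i (fun=> 1).
have BE i (w : 'I_1 -> R) : (i <= d.+1)%N -> B i w = w ord0 ^+ (d.+1 - i) * b i.
  move=> led; rewrite -(hformZv _ _ (fB i led)); congr (B i).
  by apply: funext => j; rewrite mulr1 (ord1 j).
have gE x y : g (rot (vec2 x y)) = \sum_(i < d.+2) x ^+ i * (y ^+ (d.+1 - i) * b i).
  by rewrite gB; apply: eq_bigr => i _; rewrite BE // -ltnS.
have bd : b d.+1 = 0.
  have := gE 1 0; rewrite big_ord_recr big1 /=; last first.
    by move=> i _; rewrite subSn -1?ltnS // exprS !mul0r mulr0.
  rewrite expr1n subnn expr0 !mul1r add0r => <-; apply: etrans gu; congr g.
  by apply: funext => i; rewrite /rot vec2_0 vec2_1 mul1r mul0r addr0.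
pose g1 w := N^-1 * \sum_(i < d.+1)
  (N^-1 * dot u w) ^+ i * ((N^-1 * wedge u w) ^+ (d - i) * b i).
exists g1.
  apply/hformZ/hform_sum => i.
  have := hformZ (b i) (hformM (hformX i (hformZ N^-1 (hform_dot u)))
     (hformX (d - i) (hformZ N^-1 (hform_wedge u)))).
  rewrite !mul1n subnKC -1?ltnS //; congr hform.
  by apply: funext => w; rewrite mulrC mulrA.
move=> w; have wE : w = rot (vec2 (N^-1 * dot u w) (N^-1 * wedge u w)).
  apply: funext => i; rewrite /rot vec2_0 vec2_1.
  apply: (mulfI Nn0); rewrite mulrDr !mulrA mulfV // !mul1r /N /dot /wedge /perp.
  case: (unliftP ord0 i) => [j ->|->]; last by rewrite vec2_0; ring.
  by rewrite (ord1 j) vec2_1; ring.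
rewrite [in LHS]wE gE big_ord_recr /= bd !mulr0 addr0 /g1 mulrA big_distrr /=.
apply: eq_bigr => i _; rewrite subSn -1?ltnS // exprS; ring.
Qed.

(** The complement of the line spanned by u is dense. *)
Lemma form_ge0_off_line d (h : ('I_2 -> R) -> R) u : hform d h ->
    (exists i, u i != 0) -> (forall w, wedge u w != 0 -> 0 <= h w) ->
  forall w, 0 <= h w.
Proof.
move=> fh /dot_gt0 N0 hge w; have [w0|/hge//] := eqVneq (wedge u w) 0.
have [p hp] := hform_line w (perp u) fh.
have -> : h w = p.[0].
  by rewrite -hp; congr h; apply: funext => i; rewrite mul0r addr0.
apply: poly_ge0_at0 => t t0; rewrite -hp; apply: hge.
by rewrite wedge_line // mulf_neq0 // gt_eqF.
Qed.

(** A nonnegative function cannot change sign across a zero, so a linear factor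
occurs twice. *)
Lemma psd_div_wedge2 d (g : ('I_2 -> R) -> R) u : hform d.+2 g ->
    (forall w, 0 <= g w) -> (exists i, u i != 0) -> g u = 0 ->
  exists g1, [/\ hform d g1, forall w, g w = wedge u w ^+ 2 * g1 w
    & forall w, 0 <= g1 w].
Proof.
move=> fg gge0 un0 gu; have N0 := dot_gt0 un0.
have [g1 fg1 gE] := form_div_wedge fg un0 gu.
have [p hp] := hform_line u (perp u) fg1.
have uu : wedge u u = 0 by rewrite /wedge mulrC subrr.
have g1u : g1 u = 0.
  have -> : g1 u = p.[0].
    by rewrite -hp; congr g1; apply: funext => i; rewrite mul0r addr0.
  apply: poly_sign_root => t; have := gge0 (fun i => u i + t * perp u i).
  by rewrite gE wedge_line // hp mulrAC pmulr_lge0.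
have [g2 fg2 g1E] := form_div_wedge fg1 un0 g1u.
have gE2 w : g w = wedge u w ^+ 2 * g2 w by rewrite gE g1E mulrA expr2.
exists g2; split => //; apply: (form_ge0_off_line fg2 un0) => w w0.
by have := gge0 w; rewrite gE2 pmulr_rge0 // exprn_even_gt0.
Qed.

Lemma norm2_pow_sos k : sos (hform k) (fun w => dot w w ^+ k).
Proof.
elim: k => [|k IH].
  apply: sos_ext (sos_sqr (q := fun=> 1) (hform_const _ _)) _ => w.
  by rewrite expr0 expr1n.
have lift_form i (q : ('I_2 -> R) -> R) : hform k q -> hform k.+1 (fun w => w i * q w).
  by move=> fq; apply: (@hformM R 2 1 k) => //; apply: hform_coord.
apply: sos_ext (sosD (sos_pull (@lift_form i0) IH) (sos_pull (@lift_form i1) IH)) _.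
by move=> w; rewrite [RHS]exprS -mulrDl {3}/dot !expr2.
Qed.

(** Subtracting the largest possible multiple of a power of the norm produces a
zero, hence a squared linear factor; the quotient has smaller degree. *)
Lemma binary_sos k (g : ('I_2 -> R) -> R) : hform k.*2 g ->
  (forall w, 0 <= g w) -> sos (hform k) g.
Proof.
elim: k g => [|k IH] g fg gge0.
  apply: sos_ext (sos_sqr (q := fun=> Num.sqrt (g (fun=> 0))) (hform_const _ _)) _ => w.
  by rewrite (hform0_const w fg) sqr_sqrtr.
have fN : hform k.+1.*2 (fun w => dot w w ^+ k.+1).
  rewrite -mul2n; apply/hformX/hformD; exact: (hformM (hform_coord _ _) (hform_coord _ _)).
have Npos w : (exists i, w i != 0) -> 0 < dot w w ^+ k.+1.
  by move=> /dot_gt0 w0; rewrite exprn_gt0.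
have [u un0 umin] := hform_ratio_min fg fN Npos.
have Nu := Npos u un0; set e := g u / dot u u ^+ k.+1.
have fg' : hform k.*2.+2 (fun w => g w - e * dot w w ^+ k.+1).
  by apply: hformB => //; exact/hformZ.
have [||g1 [fg1 gE g1ge0]] := psd_div_wedge2 fg' _ un0.
- by move=> w; rewrite subr_ge0 /e mulrAC ler_pdivrMr.
- by rewrite /e divfK ?subrr // gt_eqF.
have lift_form (q : ('I_2 -> R) -> R) : hform k q -> hform k.+1 (fun w => wedge u w * q w).
  by move=> fq; apply: (@hformM R 2 1 k) => //; apply: hform_wedge.
have e0 : 0 <= e by rewrite divr_ge0 // ltW.
apply: sos_ext (sosD (sos_pull lift_form (IH g1 fg1 g1ge0)) (sosZ e0 (norm2_pow_sos k.+1))) _.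
by move=> w; rewrite -gE subrK.
Qed.

End Binary.

(** * Ternary quartics *)

Section Quartic.
Local Open Scope ring_scope.
Variable R : realType.
Implicit Types (u w : 'I_2 -> R) (f G h : ('I_2 -> R) -> R).

(** One round of the reduction of x^2 f + x G + h with f positive. Removing eps
f^(e + 1) from h makes the minimum of the discriminant 4 f h - G^2, relative to
f^(e + 2), equal to 0, say at u. There the quadratic polynomial in x has a
double root mu; shifting x by l with l u = mu turns u into a zero of both new
coefficients, from which [wedge u] and its square can be extracted. The cases
e = 1 and e = 0 are used in turn for quartics. *)
Lemma shift_to_zero e f G h :
    hform 2 f -> hform e.+2 G -> hform e.*2.+2 h ->
    (forall w, (exists i, w i != 0) -> 0 < f w) ->
    (forall w, 0 <= 4 * f w * h w - G w ^+ 2) ->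
  exists eps l u G1 h1, [/\ 0 <= eps, hform e l, hform e.+1 G1, hform e.*2 h1 &
    [/\ forall w, G w + 2 * l w * f w = wedge u w * G1 w,
     forall w, h w + l w * G w + l w ^+ 2 * f w =
        eps * f w ^+ e.+1 + wedge u w ^+ 2 * h1 w,
     exists i, u i != 0 & forall w, 0 <= 4 * f w * h1 w - G1 w ^+ 2]].
Proof.
move=> ff fG fh fpos Dge0.
have fD : hform (2 * e.+2) (fun w => 4 * f w * h w - G w ^+ 2).
  apply: hformB; last first.
    by rewrite mulnC; apply: hformX.
  have -> : (2 * e.+2 = 2 + e.*2.+2)%N by rewrite mul2n doubleS.
  by apply: hformM => //; apply: hformZ.
have fpos3 w : (exists i, w i != 0) -> 0 < f w ^+ e.+2.
  by move=> /fpos fw; rewrite exprn_gt0.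
have [u un0 umin] := hform_ratio_min fD (hformX e.+2 ff) fpos3.
have fu := fpos u un0; have fu3 := fpos3 u un0.
set D := fun w => _ in fD Dge0 umin.
pose eps := D u / f u ^+ e.+2.
have eps0 : 0 <= eps by rewrite divr_ge0 ?Dge0 // ltW.
pose mu := - G u / (2 * f u); pose l w := mu * ((dot u u)^-1 * dot u w) ^+ e.
have N0 := dot_gt0 un0.
have lu : l u = mu by rewrite /l mulVf ?gt_eqF // expr1n mulr1.
have fl : hform e l.
  by apply: hformZ; rewrite -[X in hform X]mul1n; apply/hformX/hformZ/hform_dot.
pose G' w := G w + 2 * l w * f w.
pose h' w := h w + l w * G w + l w ^+ 2 * f w - (4^-1 * eps) * f w ^+ e.+1.
have fG' : hform e.+2 G'.
  apply: hformD => //; have := hformM (hformZ 2 fl) ff; by rewrite addn2.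
have fh' : hform e.*2.+2 h'.
  apply: hformB; first apply: hformD; first apply: hformD => //.
  - by have := hformM fl fG; rewrite !addnS addnn.
  - by have := hformM (hformX 2 fl) ff; rewrite addn2 muln2.
  - by have := hformZ (4^-1 * eps) (hformX e.+1 ff); rewrite mul2n doubleS.
have D'E w : 4 * f w * h' w - G' w ^+ 2 = D w - eps * f w ^+ e.+2.
  by rewrite /h' /G' /D /= [f w ^+ e.+2]exprS; field.
have D'ge0 w : 0 <= 4 * f w * h' w - G' w ^+ 2.
  by rewrite D'E subr_ge0 /eps mulrAC ler_pdivrMr.
have G'u : G' u = 0.
  by rewrite /G' lu /mu; field; rewrite gt_eqF.
have h'u : h' u = 0.
  have := D'E u; rewrite G'u expr0n subr0 /eps divfK ?gt_eqF // subrr => /eqP.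
  by rewrite mulf_eq0 mulf_eq0 pnatr_eq0 (gt_eqF fu) /= => /eqP.
have h'ge0 w : 0 <= h' w.
  have [/fpos fw|w0] := pselect (exists i, w i != 0).
    have : 0 <= 4 * f w * h' w.
      by apply: le_trans (sqr_ge0 (G' w)) _; rewrite -subr_ge0.
    by rewrite pmulr_rge0 // mulr_gt0.
  have -> : w = (fun=> 0).
    by apply: funext => i; apply/eqP/negPn/negP => wi; apply: w0; exists i.
  by rewrite (hform_at0 fh').
have [G1 fG1 G'E] := form_div_wedge fG' un0 G'u.
have [h1 [fh1 h'E h1ge0]] := psd_div_wedge2 fh' h'ge0 un0 h'u.
exists (4^-1 * eps), l, u, G1, h1; split => //.
  by rewrite mulr_ge0 // invr_ge0.
split => //.
  by move=> w; rewrite -h'E /h' [RHS]addrC subrK.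
have fD1 : hform (2 + e.*2) (fun w => 4 * f w * h1 w - G1 w ^+ 2).
  apply: hformB; first by apply: hformM => //; apply: hformZ.
  by have := hformX 2 fG1; rewrite muln2 doubleS.
apply: (form_ge0_off_line fD1 un0) => w wn0.
have := D'ge0 w; rewrite G'E h'E.
have -> : 4 * f w * (wedge u w ^+ 2 * h1 w) - (wedge u w * G1 w) ^+ 2 =
  wedge u w ^+ 2 * (4 * f w * h1 w - G1 w ^+ 2) by ring.
by rewrite pmulr_rge0 // exprn_even_gt0.
Qed.

Definition tail (v : 'I_3 -> R) : 'I_2 -> R := fun j => v (lift ord0 j).

(** Ternary quartics are handled as functions of the distinguished variable x
and of the pair w of the other two. *)
Definition sos3 (F : R -> ('I_2 -> R) -> R) :=
  sos (hform 2) (fun v : 'I_3 -> R => F (v ord0) (tail v)).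

Lemma hform_tail d g : hform d g -> hform d (fun v : 'I_3 -> R => g (tail v)).
Proof. by move=> fg; apply: (hform_comp fg) => i; exact: hform_coord. Qed.

Lemma sos3_ext F F' : sos3 F -> (forall x w, F x w = F' x w) -> sos3 F'.
Proof. by move=> sF FF'; apply: sos_ext sF _ => v; exact: FF'. Qed.

Lemma sos3D F F' : sos3 F -> sos3 F' -> sos3 (fun x w => F x w + F' x w).
Proof. exact: sosD. Qed.

Lemma sos3_tail g : sos (hform 2) g -> sos3 (fun _ w => g w).
Proof.
move=> sg; apply: sos_ext (sos_pull (m := fun=> 1) (g := tail) _ sg) _.
  by move=> q fq; apply: hformZ; exact: hform_tail.
by move=> v; rewrite expr1n mul1r.
Qed.

Lemma sos3_mul (m : R -> ('I_2 -> R) -> R) g :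
    hform 1 (fun v : 'I_3 -> R => m (v ord0) (tail v)) ->
  sos (hform 1) g -> sos3 (fun x w => m x w ^+ 2 * g w).
Proof.
move=> fm; apply: (sos_pull (m := fun v => m (v ord0) (tail v)) (g := tail)) => q fq.
by apply: (hformM fm); exact: hform_tail.
Qed.

Lemma sos3_shift F l : hform 1 l -> sos3 F -> sos3 (fun x w => F (x + l w) w).
Proof.
move=> fl sF.
pose T (v : 'I_3 -> R) := fcons (v ord0 + l (tail v)) (tail v).
apply: sos_ext (sos_pull (m := fun=> 1) (g := T) _ sF) _.
  move=> q fq; apply: hformZ; apply: (hform_comp (l := fun i v => T v i) fq) => i.
  rewrite /T; case: (unliftP ord0 i) => [j ->|->].
    have := hform_coord R (lift (@ord0 2) j); congr hform; apply: funext => v.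
    by rewrite fconsS.
  have := hformD (hform_coord R (@ord0 2)) (hform_tail fl); congr hform.
  by apply: funext => v; rewrite fcons0.
move=> v; rewrite expr1n mul1r /T fcons0; congr F.
by apply: funext => j; rewrite /tail fconsS.
Qed.

(** Two rounds of [shift_to_zero] give linear forms l = [wedge u] and
l' = [wedge u'] and reduce the problem to y^2 f + y l l' m + k0 l^2 l'^2, with
m linear and 4 k0 f - m^2 >= 0. If k0 > 0 this is
k0 (l l' + y m / (2 k0))^2 + y^2 (f - m^2 / (4 k0)); if k0 = 0 then m = 0. *)
Lemma quartic_pos_case f G h :
    hform 2 f -> hform 3 G -> hform 4 h ->
    (forall w, (exists i, w i != 0) -> 0 < f w) ->
    (forall w, 0 <= f w) ->
    (forall w, 0 <= 4 * f w * h w - G w ^+ 2) ->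
  sos3 (fun x w => x ^+ 2 * f w + x * G w + h w).
Proof.
move=> ff fG fh fpos fge0 D0.
have [e1 [l [u [G1 [h1 [e1ge0 fl fG1 fh1]]]]]] := @shift_to_zero 1 f G h ff fG fh fpos D0.
move=> [GE hE un0 D1].
have [e2 [a [u' [m [k [e2ge0 fa fm fk]]]]]] := @shift_to_zero 0 f G1 h1 ff fG1 fh1 fpos D1.
move=> [G1E h1E u'n0 D2].
have aE w : a w = a (fun=> 0) by apply: hform0_const.
have kE w : k w = k (fun=> 0) by apply: hform0_const.
set a0 := a _ in aE; set k0 := k _ in kE.
have sf : sos (hform 1) f by apply: binary_sos.
have fc : hform 1 (fun v : 'I_3 -> R => v ord0) by exact: hform_coord.
have sY : sos3 (fun y w => y ^+ 2 * f w + y * (wedge u w * wedge u' w * m w)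
    + k0 * (wedge u w * wedge u' w) ^+ 2).
  have k0ge0 : 0 <= k0.
    have := D2 u'; rewrite kE => h0.
    have : 0 <= 4 * f u' * k0 by apply: le_trans (sqr_ge0 (m u')) _; rewrite -subr_ge0.
    by rewrite pmulr_rge0 // mulr_gt0 // fpos.
  have [k00|kn0] := eqVneq k0 0.
    have m0 w : m w = 0.
      have := D2 w; rewrite kE k00 mulr0 sub0r oppr_ge0 => mle.
      by apply/eqP; rewrite -sqrf_eq0 eq_le mle sqr_ge0.
    apply: sos3_ext (sos3_mul (m := fun y _ => y) fc sf) _ => y w.
    by rewrite k00 m0; ring.
  have kp : 0 < k0 by rewrite lt_def kn0.
  set s := Num.sqrt k0; have s2 : s ^+ 2 = k0 by rewrite sqr_sqrtr.
  have sn0 : s != 0 by rewrite gt_eqF // sqrtr_gt0.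
  have sr : sos (hform 1) (fun w => f w - (4 * k0)^-1 * m w ^+ 2).
    apply: binary_sos.
      by apply: hformB => //; apply/hformZ/(@hformX _ _ 1 2).
    move=> w; have := D2 w; rewrite kE => h0.
    have -> : f w - (4 * k0)^-1 * m w ^+ 2 = (4 * f w * k0 - m w ^+ 2) / (4 * k0).
      by field.
    by rewrite divr_ge0 // mulr_ge0.
  have fq : hform 2 (fun v : 'I_3 -> R => s * (wedge u (tail v) * wedge u' (tail v))
      + (2 * s)^-1 * (v ord0 * m (tail v))).
    apply: hformD; apply: hformZ.
      by apply: (@hformM _ _ 1 1); apply: hform_tail; exact: hform_wedge.
    by apply: (@hformM _ _ 1 1) => //; apply: hform_tail.
  have sq : sos3 (fun y w => (s * (wedge u w * wedge u' w) + (2 * s)^-1 * (y * m w)) ^+ 2).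
    exact: sos_sqr fq.
  apply: sos3_ext (sos3D sq (sos3_mul (m := fun y _ => y) fc sr)) _.
  by move=> y w; rewrite -s2 /=; clearbody s; field.
have fa1 : hform 1 (fun w => - a0 * wedge u w) by apply/hformZ/hform_wedge.
have swf : sos3 (fun x w => e2 * (wedge u w ^+ 2 * f w)).
  apply: sosZ => //; apply: (sos3_mul (m := fun _ w => wedge u w)) => //.
  by apply: hform_tail; exact: hform_wedge.
have sX : sos3 (fun x w => x ^+ 2 * f w + x * (wedge u w * G1 w) + wedge u w ^+ 2 * h1 w).
  apply: sos3_ext (sos3D (sos3_shift fa1 sY) swf) _ => x w.
  have := h1E w; rewrite aE kE -/a0 -/k0 expr1 => h1w.
  have := G1E w; rewrite aE -/a0 => G1w.
  transitivity ((x - a0 * wedge u w) ^+ 2 * f w +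
    (x - a0 * wedge u w) * wedge u w * (wedge u' w * m w) +
    wedge u w ^+ 2 * (e2 * f w + wedge u' w ^+ 2 * k0)); first by ring.
  by rewrite -G1w -h1w; ring.
have fl1 : hform 1 (fun w => - 1 * l w) by apply/hformZ.
have sff : sos3 (fun x w => e1 * f w ^+ 2).
  by apply: sosZ => //; apply: sos_sqr; apply: hform_tail.
apply: sos3_ext (sos3D (sos3_shift fl1 sX) sff) _ => x w.
transitivity ((x - l w) ^+ 2 * f w + (x - l w) * (wedge u w * G1 w)
   + (e1 * f w ^+ 2 + wedge u w ^+ 2 * h1 w)); first by ring.
by rewrite -GE -hE; ring.
Qed.

(** Here f = k0 l^2 with l = [wedge u]. Where l vanishes so does G, since
G^2 <= 4 f h; hence G = l G1 and the quartic is
k0 (x l + G1 / (2 k0))^2 + (h - G1^2 / (4 k0)), the last term being a binary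
quartic that is nonnegative off the line l = 0. *)
Lemma quartic_degenerate_case f G h u :
    hform 2 f -> hform 3 G -> hform 4 h ->
    (exists i, u i != 0) -> f u = 0 ->
    (forall w, 0 <= f w) -> (forall w, 0 <= h w) ->
    (forall w, 0 <= 4 * f w * h w - G w ^+ 2) ->
  sos3 (fun x w => x ^+ 2 * f w + x * G w + h w).
Proof.
move=> ff fG fh un0 fu fge0 hge0 D0.
have [k [fk fE kge0]] := psd_div_wedge2 ff fge0 un0 fu.
have kE w : k w = k (fun=> 0) by apply: hform0_const.
set k0 := k _ in kE.
have k0ge0 : 0 <= k0 by apply: kge0.
have [k00|kn0] := eqVneq k0 0.
  have f0 w : f w = 0 by rewrite fE kE k00 mulr0.
  have G0 w : G w = 0.
    have := D0 w; rewrite f0 mulr0 mul0r sub0r oppr_ge0 => Gle.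
    by apply/eqP; rewrite -sqrf_eq0 eq_le Gle sqr_ge0.
  apply: sos3_ext (sos3_tail (@binary_sos _ 2 _ fh hge0)) _ => x w.
  by rewrite f0 G0 !mulr0 !add0r.
have kp : 0 < k0 by rewrite lt_def kn0.
have Gu : G u = 0.
  have := D0 u; rewrite fu mulr0 mul0r sub0r oppr_ge0 => Gle.
  by apply/eqP; rewrite -sqrf_eq0 eq_le Gle sqr_ge0.
have [G1 fG1 GE] := form_div_wedge fG un0 Gu.
set s := Num.sqrt k0; have s2 : s ^+ 2 = k0 by rewrite sqr_sqrtr.
have sn0 : s != 0 by rewrite gt_eqF // sqrtr_gt0.
have fr : hform 4 (fun w => h w - (4 * k0)^-1 * G1 w ^+ 2).
  by apply: hformB => //; apply/hformZ/(@hformX _ _ 2 2).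
have sr : sos (hform 2) (fun w => h w - (4 * k0)^-1 * G1 w ^+ 2).
  apply: binary_sos => //; apply: (form_ge0_off_line fr un0) => w wn0.
  have : 0 <= wedge u w ^+ 2 * (4 * k0) * (h w - (4 * k0)^-1 * G1 w ^+ 2).
    have := D0 w; rewrite GE fE kE -/k0; congr (0 <= _); by field.
  have wp : 0 < wedge u w ^+ 2 * (4 * k0).
    by apply: mulr_gt0; rewrite ?exprn_even_gt0 // mulr_gt0.
  by rewrite pmulr_rge0.
have fq : hform 2 (fun v : 'I_3 -> R => s * (v ord0 * wedge u (tail v))
    + (2 * s)^-1 * G1 (tail v)).
  apply: hformD; apply: hformZ; last exact: hform_tail.
  apply: (@hformM _ _ 1 1); first exact: hform_coord.
  by apply: hform_tail; exact: hform_wedge.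
have sq : sos3 (fun y w => (s * (y * wedge u w) + (2 * s)^-1 * G1 w) ^+ 2).
  exact: sos_sqr fq.
apply: sos3_ext (sos3D sq (sos3_tail sr)) _.
by move=> y w; rewrite fE kE -/k0 GE -s2 /=; clearbody s; field.
Qed.

(** A zero at (1, 0, 0) is a minimum, so the terms in x^4 and x^3 are absent. *)
Lemma quartic_at_zero (F : ('I_3 -> R) -> R) : hform 4 F ->
  (forall v, 0 <= F v) -> F (fcons 1 (fun=> 0)) = 0 -> sos (hform 2) F.
Proof.
move=> fF Fge0 F0; have [B fB FB] := hform_cons fF.
have FE x w : F (fcons x w) = B 0%N w + x * B 1%N w + x ^+ 2 * B 2%N w +
    x ^+ 3 * B 3%N w + x ^+ 4 * B 4%N w.
  by rewrite FB !big_ord_recr big_ord0 /= add0r expr0 mul1r expr1.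
have B0 i : (i < 4)%N -> B i (fun=> 0) = 0.
  by move=> i4; have := fB i (ltnW i4); rewrite subSn //; exact: hform_at0.
have B4 w : B 4%N w = 0.
  rewrite (hform0_const w (fB 4%N _)) //; move: F0.
  by rewrite FE (B0 0%N) // (B0 1%N) // (B0 2%N) // (B0 3%N) // !mulr0 !add0r expr1n mul1r.
have B3 w : B 3%N w = 0.
  (* t p(t) is the restriction of F to the line through (1, 0) directed by
     (0, w) *)
  pose p := (B 3%N w)%:P + 'X * (B 2%N w)%:P + 'X^2 * (B 1%N w)%:P + 'X^3 * (B 0%N w)%:P.
  have <- : p.[0] = B 3%N w by rewrite /p !hornerE; ring.
  apply: poly_sign_root => t; have := Fge0 (fcons 1 (fun i => t * w i)).
  rewrite FE B4 !expr1n !mul1r addr0.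
  rewrite !(hformZv _ _ (fB _ _)) //= /p !hornerE.
  by congr (0 <= _); rewrite /= subn0 !subSS !subn0; ring.
have FE2 x w : F (fcons x w) = x ^+ 2 * B 2%N w + x * B 1%N w + B 0%N w.
  by rewrite FE B3 B4; ring.
have H w : [/\ 0 <= B 2%N w, 0 <= B 0%N w & 0 <= 4 * B 2%N w * B 0%N w - B 1%N w ^+ 2].
  by apply: quadratic_ge0 => x; rewrite -FE2.
suff: sos3 (fun x w => x ^+ 2 * B 2%N w + x * B 1%N w + B 0%N w).
  by move=> /sos_ext; apply => v; rewrite -FE2 [in RHS](fcons_eta v).
have f2 : forall w, 0 <= B 2%N w by move=> w; have [] := H w.
have h2 : forall w, 0 <= B 0%N w by move=> w; have [] := H w.
have D2 : forall w, 0 <= 4 * B 2%N w * B 0%N w - B 1%N w ^+ 2 by move=> w; have [] := H w.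
have [[u un0 fu]|nz] := pselect (exists2 u, exists i, u i != 0 & B 2%N u = 0).
  apply: quartic_degenerate_case un0 fu f2 h2 D2.
  - exact: (fB 2%N).
  - exact: (fB 1%N).
  - exact: (fB 0%N).
apply: quartic_pos_case => //; [exact: (fB 2%N)|exact: (fB 1%N)|exact: (fB 0%N)|].
by move=> w wn0; rewrite lt_def f2 andbT; apply/negP => /eqP w0; apply: nz; exists w.
Qed.

(** Complete p to a basis by all but one of the unit vectors, the omitted one
corresponding to a nonzero coordinate of p. *)
Lemma move_to_axis n (p : 'I_n.+1 -> R) : (exists i, p i != 0) ->
  exists A B : ('I_n.+1 -> R) -> ('I_n.+1 -> R),
  [/\ forall i, hform 1 (fun v => A v i), forall i, hform 1 (fun v => B v i),
      forall v, A (B v) = v & A (fcons 1 (fun=> 0)) = p].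
Proof.
move=> [i pi0].
pose A (v : 'I_n.+1 -> R) k : R :=
  p k * v ord0 + oapp (fun j => v (lift ord0 j)) 0 (unlift i k).
pose B (v : 'I_n.+1 -> R) := fcons ((p i)^-1 * v i)
  (fun j => v (lift i j) - p (lift i j) * ((p i)^-1 * v i)).
exists A, B; split.
- move=> k; apply: hformD; first exact/hformZ/hform_coord.
  by case: (unlift i k) => [j|] /=; [exact: hform_coord|exact: hform_zero].
- move=> k; rewrite /B; case: (unliftP ord0 k) => [j ->|->].
    have := hformB (hform_coord R (lift i j))
      (hformZ (p (lift i j)) (hformZ (p i)^-1 (hform_coord R i))).
    by congr hform; apply: funext => v; rewrite fconsS.
  have := hformZ (p i)^-1 (hform_coord R i); congr hform.
  by apply: funext => v; rewrite fcons0.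
- move=> v; apply: funext => k; rewrite /A /B fcons0.
  case: (unliftP i k) => [j ->|->]; last by rewrite /= addr0 mulVKf.
  by rewrite /= fconsS addrC subrK.
- apply: funext => k; rewrite /A fcons0 mulr1.
  by case: (unlift i k) => [j|] /=; rewrite ?fconsS addr0.
Qed.

(** Subtracting a multiple of the square of the norm produces a zero, which is
then moved to (1, 0, 0). *)
Lemma ternary_quartic_sos (F : ('I_3 -> R) -> R) : hform 4 F ->
  (forall v, 0 <= F v) -> sos (hform 2) F.
Proof.
move=> fF Fge0.
pose N (v : 'I_3 -> R) := \sum_i v i ^+ 2.
have fN : hform 2 N by apply: hform_sum => i; apply/(@hformX _ _ 1 2)/hform_coord.
have Npos v : (exists i, v i != 0) -> 0 < N v ^+ 2.
  move=> [i vi]; rewrite exprn_gt0 // /N (bigD1 i) //= ltr_pwDl ?exprn_even_gt0 //.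
  by apply: sumr_ge0 => j _; rewrite sqr_ge0.
have fN2 : hform 4 (fun v => N v ^+ 2) by apply: (@hformX _ _ 2 2).
have [p pn0 pmin] := hform_ratio_min fF fN2 Npos.
have Np := Npos p pn0; set e := F p / N p ^+ 2.
have e0 : 0 <= e by rewrite divr_ge0 // ltW.
have fF' : hform 4 (fun v => F v - e * N v ^+ 2).
  by apply: hformB => //; exact: hformZ.
have F'ge0 v : 0 <= F v - e * N v ^+ 2.
  by rewrite subr_ge0 /e mulrAC ler_pdivrMr.
have F'p : F p - e * N p ^+ 2 = 0 by rewrite /e divfK ?subrr // gt_eqF.
have [A [B [lA lB AB Ae]]] := move_to_axis pn0.
have sA : sos (hform 2) (fun v => F (A v) - e * N (A v) ^+ 2).
  apply: quartic_at_zero => //; last by rewrite Ae.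
  exact: (hform_comp (l := fun i v => A v i) fF').
have sF' : sos (hform 2) (fun v => F v - e * N v ^+ 2).
  apply: sos_ext (sos_pull (m := fun=> 1) (g := B) _ sA) _.
    by move=> q fq; apply: hformZ; exact: (hform_comp (l := fun i v => B v i) fq).
  by move=> v; rewrite AB expr1n mul1r.
apply: sos_ext (sosD sF' (sosZ e0 (sos_sqr fN))) _ => v.
by rewrite subrK.
Qed.

End Quartic.

(** * Half Newton polygon of a sum of squares *)

Section Newton.
Local Open Scope ring_scope.
Variable R : realType.

Lemma seq_argmax (T : eqType) (f : T -> int) (s : seq T) x0 : x0 \in s ->
  exists2 x, x \in s & forall y, y \in s -> f y <= f x.
Proof.
elim: s x0 => // y s IH x0 _; case: s IH => [|z s] IH.
  by exists y; rewrite ?mem_head // => u; rewrite inE => /eqP ->.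
have [x xs xmax] := IH z (mem_head _ _).
have [le|lt] := lerP (f y) (f x).
  by exists x; [rewrite inE xs orbT|move=> u; rewrite inE => /orP [/eqP -> //|/xmax]].
exists y; first exact: mem_head.
by move=> u; rewrite inE => /orP [/eqP -> //|/xmax ux]; exact: le_trans ux (ltW lt).
Qed.

Implicit Types (P Q q : {poly {poly R}}) (a b c : int).

(** The support of P lies in the half-plane a i + b j <= c, where i is the
exponent of the outer variable and j that of the inner one. *)
Definition below a b c P :=
  forall i j : nat, c < a * i%:Z + b * j%:Z -> P`_i`_j = 0.

Lemma coef2M P Q i j : (P * Q)`_i`_j =
  \sum_(i' < i.+1) \sum_(j' < j.+1) P`_i'`_j' * Q`_(i - i')`_(j - j').
Proof. by rewrite coefM coef_sum; apply: eq_bigr => i' _; rewrite coefM. Qed.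

Lemma belowM a b c c' P Q :
  below a b c P -> below a b c' Q -> below a b (c + c') (P * Q).
Proof.
move=> hP hQ i j lt; rewrite coef2M big1 // => i' _; rewrite big1 // => j' _.
have [le|gt] := lerP (a * i'%:Z + b * j'%:Z) c; last by rewrite hP ?mul0r.
rewrite (hQ (i - i')%N) ?mulr0 //.
have hi := leq_ord i'; have hj := leq_ord j'.
by rewrite -!subzn //; lia.
Qed.

Lemma belowD a b c P Q : below a b c P -> below a b c Q -> below a b c (P + Q).
Proof. by move=> hP hQ i j lt; rewrite !coefD hP ?hQ ?addr0. Qed.

Lemma belowN a b c P : below a b c P -> below a b c (- P).
Proof. by move=> hP i j lt; rewrite !coefN hP ?oppr0. Qed.

Lemma belowW a b c c' P : c <= c' -> below a b c P -> below a b c' P.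
Proof. by move=> le hP i j lt; rewrite hP //; exact: le_lt_trans le lt. Qed.

Lemma below1 a b : below a b 0 1.
Proof.
move=> i j; rewrite -polyC1 coefC; case: eqP => [->|]; last by rewrite coef0.
by rewrite -polyC1 coefC; case: eqP => [->|//]; rewrite !mulr0 addr0.
Qed.

Lemma belowXn a b c P k : below a b c P -> below a b (k%:Z * c) (P ^+ k).
Proof.
move=> hP; elim: k => [|k IH]; first by rewrite mul0r; exact: below1.
by rewrite exprS -addn1 PoszD mulrDl mul1r addrC; exact: belowM.
Qed.

Lemma below_outer a b : below a b a 'X.
Proof.
move=> i j; rewrite coefX; case: eqP => [->|]; last by rewrite coef0.
rewrite -polyC1 coefC; case: eqP => [->|//]; rewrite mulr1 mulr0 addr0 ltxx //.
Qed.

Lemma below_inner a b : below a b b 'X%:P.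
Proof.
move=> i j; rewrite coefC; case: eqP => [->|]; last by rewrite coef0.
by rewrite coefX; case: eqP => [->|//]; rewrite mulr1 mulr0 add0r ltxx.
Qed.

(** Take a monomial of the q with the largest weight a i + b j and, among
those, with the largest i; as b is nonzero this determines (i0, j0). Its double
is a sum of two monomials of some q in only one way, so the coefficient of the
sum of squares at (2 i0, 2 j0) is a sum of squares of real numbers, not all
zero. Hence twice the largest weight is at most 2 c. *)
Lemma sos_below a b c P (s : seq {poly {poly R}}) : b != 0 ->
    P = \sum_(q <- s) q ^+ 2 -> below a b (2 * c) P ->
  forall q, q \in s -> below a b c q.
Proof.
move=> b0 PE hP q qs i j lt; apply/eqP/negPn/negP => qij.
pose L := [seq p <- flatten [seq flatten [seq [seq (i', j') | j' <- iota 0 (size q'`_i')]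
   | i' <- iota 0 (size q')] | q' <- s] | has (fun q' => q'`_p.1`_p.2 != 0) s].
have LP q' i' j' : q' \in s -> q'`_i'`_j' != 0 -> (i', j') \in L.
  move=> q's nz; have i's : (i' < size q')%N.
    by rewrite ltnNge; apply/negP => le; case/eqP: nz; rewrite (nth_default 0 le) coef0.
  have j's : (j' < size (q'`_i')%R)%N.
    by rewrite ltnNge; apply/negP => le; case/eqP: nz; rewrite (nth_default 0 le).
  rewrite mem_filter; apply/andP; split; first by apply/hasP; exists q'.
  apply/flattenP; exists [seq (i', j') | i' <- iota 0 (size q'), j' <- iota 0 (size q'`_i')].
    by apply/mapP; exists q'.
  by apply/allpairsPdep; exists i', j'; rewrite !mem_iota.
pose om (p : nat * nat) : int := a * p.1%:Z + b * p.2%:Z.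
have [p1 p1L p1max] := seq_argmax om (LP q i j qs qij).
have p1F : p1 \in [seq p <- L | om p == om p1] by rewrite mem_filter eqxx.
have [[i0 j0]] := seq_argmax (fun p => p.1%:Z) p1F.
rewrite mem_filter => /andP [/eqP om0 p0L] p0max.
have om0max i' j' q' : q' \in s -> q'`_i'`_j' != 0 -> om (i', j') <= om (i0, j0).
  by move=> q's nz; rewrite om0; apply: p1max; exact: LP nz.
have i0max i' j' q' : q' \in s -> q'`_i'`_j' != 0 -> om (i', j') = om (i0, j0) ->
    (i' <= i0)%N.
  move=> q's nz e; have := p0max (i', j'); rewrite mem_filter e om0 eqxx /=.
  by rewrite (LP _ _ _ q's nz) lez_nat => /(_ isT).
have sqE q' : q' \in s -> (q' ^+ 2)`_(2 * i0)`_(2 * j0) = q'`_i0`_j0 ^+ 2.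
  move=> q's; rewrite expr2 coef2M.
  have i0lt : (i0 < (2 * i0).+1)%N by lia.
  have j0lt : (j0 < (2 * j0).+1)%N by lia.
  have z i' j' : (i' <= 2 * i0)%N -> (j' <= 2 * j0)%N -> (i' != i0) || (j' != j0) ->
      q'`_i'`_j' * q'`_(2 * i0 - i')`_(2 * j0 - j') = 0.
    move=> lei lej ne; apply/eqP; rewrite mulf_eq0; apply/negPn/negP; rewrite negb_or.
    move=> /andP [n1 n2]; have o1 := om0max _ _ _ q's n1; have o2 := om0max _ _ _ q's n2.
    have m1 := i0max _ _ _ q's n1; have m2 := i0max _ _ _ q's n2.
    move: o1 o2 m1 m2; rewrite /om /= -!subzn // !PoszM => o1 o2 m1 m2.
    have e1 : a * i'%:Z + b * j'%:Z = a * i0%:Z + b * j0%:Z by lia.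
    have := m1 e1; have := m2; rewrite mulrBr => {}m2.
    have e2 : a * (2 * i0%:Z) - a * i'%:Z + b * (2 * j0%:Z - j'%:Z) =
        a * i0%:Z + b * j0%:Z by lia.
    have := m2 e2 => le2 le1; have ei : i' = i0 by lia.
    move: e1; rewrite ei => /addrI /(mulfI b0) [ej].
    by rewrite ei ej !eqxx in ne.
  rewrite (bigD1 (Ordinal i0lt)) //= (bigD1 (Ordinal j0lt)) //= !big1 ?addr0.
  - by rewrite mul2n -addnn addnK mul2n -addnn addnK expr2.
  - move=> i' ne; rewrite big1 // => j' _; apply: z; rewrite ?leq_ord //.
    by rewrite -(inj_eq val_inj) /= in ne; rewrite ne.
  - move=> j' ne; apply: z; [by rewrite leq_pmull|exact: leq_ord|].
    by rewrite -(inj_eq val_inj) /= in ne; rewrite ne orbT.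
have P0 : P`_(2 * i0)`_(2 * j0) = 0.
  apply: hP; have := om0max _ _ _ qs qij; rewrite /om /= !PoszM => h; lia.
move: P0; rewrite PE !coef_sum big_seq (eq_bigr (fun q' => q'`_i0`_j0 ^+ 2)); last first.
  by move=> q' q's; exact: sqE.
rewrite -big_seq => /eqP; rewrite psumr_eq0; last by move=> q' _; exact: sqr_ge0.
move=> /allP z0; move: p0L; rewrite mem_filter => /andP [/hasP [q' q's /= nz] _].
by have := z0 q' q's; rewrite /= sqrf_eq0 (negbTE nz).
Qed.

End Newton.

(** * The Choi-Lam polynomial and its parity parts *)

Section Parity.
Local Open Scope ring_scope.
Variable A : comNzRingType.
Implicit Types p : {poly A}.

Lemma even_poly_comp p : even_poly (p \Po 'X^2) = p.
Proof.
by apply/polyP => i; rewrite coef_even_poly coef_comp_poly_Xn // -muln2 dvdn_mull // mulnK.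
Qed.

Lemma odd_poly_comp p : odd_poly (p \Po 'X^2) = 0.
Proof.
apply/polyP => i; rewrite coef_odd_poly coef_comp_poly_Xn // coef0.
by rewrite dvdn2 /= odd_double.
Qed.

Lemma even_poly_sqr p :
  even_poly (p ^+ 2) = even_poly p ^+ 2 + 'X * odd_poly p ^+ 2.
Proof.
have pE := poly_even_odd p; set e := even_poly p in pE *; set o := odd_poly p in pE *.
have -> : p ^+ 2 = ((e ^+ 2 + 'X * o ^+ 2) \Po 'X^2) + ((e * o *+ 2) \Po 'X^2) * 'X.
  rewrite -[in LHS]pE raddfMn /= comp_polyD !expr2 !comp_polyM comp_polyX.
  by rewrite -mulr_natr; ring.
by rewrite even_polyD even_polyMX odd_poly_comp mul0r addr0 even_poly_comp.
Qed.

Lemma poly_dvd_parity p d : (exists e, even_poly p = d * e) ->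
  (exists o, odd_poly p = d * o) -> exists r, p = (d \Po 'X^2) * r.
Proof.
move=> [e pe] [o po]; exists ((e \Po 'X^2) + (o \Po 'X^2) * 'X).
by rewrite -[LHS]poly_even_odd pe po !comp_polyM mulrDr mulrA.
Qed.

End Parity.

Section Core.
Local Open Scope ring_scope.
Variable R : realType.
Implicit Types (q r : {poly {poly R}}).

(** S(x, y) = x^4 y^2 + y^4 + x^2 - 3 x^2 y^2, with x the outer variable and y
the inner one. *)
Definition choi_lam : {poly {poly R}} :=
  'X ^+ 4 * 'Y ^+ 2 + 'Y ^+ 4 + 'X ^+ 2 - 3%:R * ('X ^+ 2 * 'Y ^+ 2).

(** The cubic m with S(x, y) = m(x^2, y^2). Here the outer variable is Y and
the inner one is X, which makes m monic in the outer variable. *)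
Definition nodal_cubic : {poly {poly R}} :=
  'Y ^+ 2 * 'X + 'X ^+ 2 + 'Y - 3%:R * ('Y * 'X).

(** The polynomial r in X = x^2 (inner) and Y = y^2 (outer) such that
x^a y^b r(x^2, y^2) is the part of q of parities a in x and b in y. *)
Definition parity_part a b q : {poly {poly R}} :=
  (if b then @odd_poly _ else @even_poly _)
    (swapXY ((if a then @odd_poly _ else @even_poly _) q)).

Lemma coef_parity_part a b q i j : (parity_part a b q)`_j`_i = q`_(i.*2 + a)`_(j.*2 + b).
Proof.
rewrite /parity_part; case: b; case: a; rewrite ?coef_odd_poly ?coef_even_poly coef_swapXY.
- by rewrite coef_odd_poly !addn1.
- by rewrite coef_even_poly addn1 addn0.
- by rewrite coef_odd_poly addn1 addn0.
- by rewrite coef_even_poly !addn0.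
Qed.

(** S written in x^2 (outer) and y (inner), halfway to [nodal_cubic]. *)
Definition choi_lam_half : {poly {poly R}} :=
  'X ^+ 2 * 'Y ^+ 2 + 'Y ^+ 4 + 'X - 3%:R * ('X * 'Y ^+ 2).

Lemma choi_lam_comp : choi_lam = choi_lam_half \Po 'X^2.
Proof.
rewrite /choi_lam_half /choi_lam !(rmorphXn, rmorph_nat, rmorphD, rmorphN, rmorphM) /=.
by rewrite !comp_polyC !comp_polyX; ring.
Qed.

Lemma swap_choi_lam_half : swapXY choi_lam_half = nodal_cubic \Po 'X^2.
Proof.
rewrite /choi_lam_half /nodal_cubic !(rmorphXn, rmorph_nat, rmorphD, rmorphN, rmorphM) /=.
by rewrite swapXY_X swapXY_Y !comp_polyC !comp_polyX; ring.
Qed.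

(** Extract from both sides the part that is even in x and in y: in q^2 it is
the sum of the squares of the four parts x^a y^b r(x^2, y^2) of q, whence the
weights X^a Y^b. *)
Lemma choi_lam_sos_parts k (s : seq {poly {poly R}}) :
    choi_lam ^+ k = \sum_(q <- s) q ^+ 2 ->
  nodal_cubic ^+ k = \sum_(q <- s)
    (parity_part false false q ^+ 2 + 'X * parity_part false true q ^+ 2
      + 'Y * (parity_part true false q ^+ 2 + 'X * parity_part true true q ^+ 2)).
Proof.
move=> /(congr1 (fun p => even_poly (swapXY (even_poly p)))).
rewrite choi_lam_comp -rmorphXn /= even_poly_comp rmorphXn /= swap_choi_lam_half -rmorphXn /=.
rewrite even_poly_comp => ->.
rewrite !raddf_sum; apply: eq_bigr => q _ /=.
rewrite even_poly_sqr !(rmorphXn, rmorphD, rmorphM) /= swapXY_X.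
by rewrite !mul_polyC even_polyD even_polyZ !even_poly_sqr.
Qed.

Lemma choi_lam_dvd_of_parts q :
    (forall a b, exists r, parity_part a b q = nodal_cubic * r) ->
  exists q', q = choi_lam * q'.
Proof.
move=> H; rewrite choi_lam_comp; apply: poly_dvd_parity.
  have [|r hr] := poly_dvd_parity (H false false); first exact: (H false true).
  exists (swapXY r); rewrite -[LHS]swapXYK hr -swap_choi_lam_half rmorphM /= swapXYK //.
have [|r hr] := poly_dvd_parity (H true false); first exact: (H true true).
by exists (swapXY r); rewrite -[LHS]swapXYK hr -swap_choi_lam_half rmorphM /= swapXYK.
Qed.

(** [sos_below] is applied once to each side of the Newton triangle of S, whose
vertices are (4, 2), (0, 4) and (2, 0). *)
Lemma choi_lam_sos_newton k (s : seq {poly {poly R}}) q i j :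
    choi_lam ^+ k = \sum_(q <- s) q ^+ 2 -> q \in s -> q`_i`_j != 0 ->
  [/\ (2 * k <= 2 * i + j)%N, (i + 2 * j <= 4 * k)%N & (i <= j + k)%N].
Proof.
move=> SE qs qij.
have bS (a b c : int) : 4 * a + 2 * b <= c -> 4 * b <= c -> 2 * a <= c -> 2 * a + 2 * b <= c ->
    below a b c choi_lam.
  move=> h1 h2 h3 h4; have bX := @below_outer R a b; have bY := @below_inner R a b.
  apply: belowD; first apply: belowD; first apply: belowD.
  - by have := belowM (belowXn (k := 4) bX) (belowXn (k := 2) bY); apply: belowW; lia.
  - by have := belowXn (k := 4) bY; apply: belowW; lia.
  - by have := belowXn (k := 2) bX; apply: belowW; lia.
  have bXY := belowM (belowXn (k := 2) bX) (belowXn (k := 2) bY).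
  apply: belowN; rewrite mulr_natl mulrS mulr2n.
  by do !apply: belowD; move: bXY; apply: belowW; lia.
have H (a b c : int) : b != 0 -> below a b (2 * c) choi_lam -> a * i%:Z + b * j%:Z <= k%:Z * c.
  move=> b0 /(belowXn (k := k)); rewrite mulrCA => bSk; rewrite leNgt; apply/negP => lt.
  by move: qij; rewrite (sos_below b0 SE bSk qs lt) eqxx.
have h1 : -2 * i%:Z + -1 * j%:Z <= k%:Z * -2 by apply: H => //; apply: bS.
have h2 : 1 * i%:Z + 2 * j%:Z <= k%:Z * 4 by apply: H => //; apply: bS.
have h3 : 1 * i%:Z + -1 * j%:Z <= k%:Z * 1 by apply: H => //; apply: bS.
by split; lia.
Qed.

End Core.

(** * Order of vanishing at the node *)

Section Node.
Local Open Scope ring_scope.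
Variable R : realType.
Implicit Types (q r f g : {poly {poly R}}).

(** The value at x for the outer variable and y for the inner one. *)
Definition ev2 (x y : R) r : R := r.[x%:P].[y].

Lemma ev2D x y r r' : ev2 x y (r + r') = ev2 x y r + ev2 x y r'.
Proof. by rewrite /ev2 !hornerD. Qed.
Lemma ev2M x y r r' : ev2 x y (r * r') = ev2 x y r * ev2 x y r'.
Proof. by rewrite /ev2 !hornerM. Qed.
Lemma ev2C x y c : ev2 x y c%:P = c.[y].
Proof. by rewrite /ev2 hornerC. Qed.
Lemma ev2X x y : ev2 x y 'X = x.
Proof. by rewrite /ev2 hornerX hornerC. Qed.

Lemma ev2N x y r : ev2 x y (- r) = - ev2 x y r.
Proof. by rewrite /ev2 !hornerN. Qed.
Lemma ev2_nat x y n : ev2 x y n%:R = n%:R.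
Proof. by rewrite -[n%:R]polyC_natr ev2C -polyC_natr hornerC. Qed.
Lemma ev2_1 x y : ev2 x y 1 = 1.
Proof. exact: (ev2_nat x y 1). Qed.
Lemma ev2Xn x y r n : ev2 x y (r ^+ n) = ev2 x y r ^+ n.
Proof. by rewrite /ev2 !horner_exp. Qed.
Lemma ev2Y x y : ev2 x y 'Y = y.
Proof. by rewrite ev2C hornerX. Qed.
Definition ev2E := (ev2_nat, ev2_1, ev2Xn, ev2D, ev2N, ev2M, ev2X, ev2Y).

Lemma bivariate_subst f g : exists phi : {rmorphism {poly {poly R}} -> {poly {poly R}}},
  [/\ phi 'X = f, phi 'Y = g
    & forall x y r, ev2 x y (phi r) = ev2 (ev2 x y f) (ev2 x y g) r].
Proof.
pose psi : {rmorphism {poly R} -> {poly {poly R}}} :=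
  horner_eval g \o map_poly (@polyC {poly R} \o @polyC R).
pose phi : {rmorphism {poly {poly R}} -> {poly {poly R}}} := horner_eval f \o map_poly psi.
have psiE x y c : ev2 x y (psi c) = c.[ev2 x y g].
  elim/poly_ind: c => [|c a IH]; first by rewrite rmorph0 horner0 /ev2 !horner0.
  rewrite rmorphD rmorphM ev2D ev2M IH !hornerE; congr (_ * _ + _).
    by rewrite /psi /= map_polyX /horner_eval hornerX.
  by rewrite /psi /= map_polyC /horner_eval /= hornerC ev2C hornerC.
have phiX : phi 'X = f by rewrite /phi /= map_polyX /horner_eval hornerX.
have phiC c : phi c%:P = psi c by rewrite /phi /= map_polyC /horner_eval hornerC.
exists phi; split => //.
  by rewrite [LHS]phiC /psi /= map_polyX /horner_eval hornerX.
move=> x y r; elim/poly_ind: r => [|r c IH].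
  by rewrite rmorph0 /ev2 !horner0.
by rewrite rmorphD rmorphM !ev2D !ev2M IH [phi 'X]phiX [phi _]phiC psiE ev2X ev2C.
Qed.

Lemma sos_poly_eq0 (s : seq {poly R}) : \sum_(p <- s) p ^+ 2 = 0 ->
  forall p, p \in s -> p = 0.
Proof.
move=> s0 p ps; apply: poly_ext => x; rewrite horner0.
have := congr1 (horner^~ x) s0; rewrite horner0 horner_sum => /eqP.
rewrite psumr_eq0; last by move=> q _; rewrite horner_exp sqr_ge0.
by move=> /allP /(_ p ps); rewrite horner_exp sqrf_eq0 => /eqP.
Qed.

(** The lowest coefficient of the sum is a sum of squares in R[w], since each
weight is 1 at t = 0; as R[w] is formally real, every term is divisible by the
outer variable t, and induction on k applies. *)
Lemma sos_divXn k (L : seq ({poly {poly R}} * {poly {poly R}})) h :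
    (forall c, c \in L -> c.1`_0 = 1) ->
    \sum_(c <- L) c.1 * c.2 ^+ 2 = h * 'X^(2 * k) ->
  forall c, c \in L -> exists g, c.2 = g * 'X^k.
Proof.
elim: k L => [|k IH] L L1 LE c cL; first by exists c.2; rewrite expr0 mulr1.
have L0 c' : c' \in L -> c'.2 = drop_poly 1 c'.2 * 'X.
  move=> c'L; rewrite -[LHS](poly_take_drop 1) expr1.
  suff -> : take_poly 1 c'.2 = 0 by rewrite add0r.
  apply/polyP => i; rewrite coef_take_poly coef0; case: i => //=.
  have cin : c'.2`_0 \in map (fun d : {poly {poly R}} * {poly {poly R}} => d.2`_0) L.
    by apply/mapP; exists c'.
  apply: (sos_poly_eq0 _ cin).
  have e : (\sum_(c <- L) c.1 * c.2 ^+ 2)`_0 = 0 by rewrite LE coefMXn mulnS.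
  apply: etrans e; rewrite big_map coef_sum; apply: eq_big_seq => c'' c''L.
  by rewrite -[RHS]horner_coef0 hornerM horner_exp !horner_coef0 L1 // mul1r.
have [|||g hg] := IH [seq (c.1, drop_poly 1 c.2) | c <- L] _ _ (c.1, drop_poly 1 c.2).
- by move=> _ /mapP [c' c'L ->] /=; exact: L1.
- have X2 : 'X^2 != 0 :> {poly {poly R}} by rewrite expf_neq0 // polyX_eq0.
  apply: (mulIf X2); rewrite big_map big_distrl /= -mulrA -exprD -mulnSr -LE.
  apply: eq_big_seq => c' c'L; by rewrite [in RHS](L0 c' c'L) exprMn; ring.
- by apply/mapP; exists c.
by exists g; rewrite (L0 c cL) exprSr mulrA -hg.
Qed.

(** The substitution X = 1 + t, Y = 1 + w t blows up the node (1, 1): it turns m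
into t^2 times a polynomial, and each monomial X^a Y^b into a polynomial equal
to 1 at t = 0. *)
Lemma parity_part_node_vanish k (s : seq {poly {poly R}})
    (phi : {rmorphism {poly {poly R}} -> {poly {poly R}}}) :
    phi 'X = 1 + 'Y * 'X -> phi 'Y = 1 + 'X ->
    choi_lam R ^+ k = \sum_(q <- s) q ^+ 2 ->
  forall q a b, q \in s -> exists h, phi (parity_part a b q) = h * 'X^k.
Proof.
move=> phiX phiY SE q a b qs.
pose Lq q := [:: (1 : {poly {poly R}}, parity_part false false q);
  ('X, parity_part false true q);
  ('Y, parity_part true false q); ('Y * 'X, parity_part true true q)].
pose L := [seq (phi c.1, phi c.2) | c <- flatten [seq Lq q | q <- s]].
have LE : \sum_(c <- L) c.1 * c.2 ^+ 2 = (1 - 'Y + 'Y ^+ 2 + 'Y * 'X) ^+ k * 'X^(2 * k).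
  transitivity (phi (nodal_cubic R ^+ k)).
    rewrite (choi_lam_sos_parts SE) rmorph_sum /L big_map big_flatten big_map /=.
    apply: eq_bigr => q' _; rewrite !big_cons big_nil /=.
    by rewrite !(rmorphXn, rmorphD, rmorphM, rmorph1); ring.
  rewrite mulrC exprM -exprMn rmorphXn; congr (_ ^+ _).
  rewrite /nodal_cubic !(rmorphXn, rmorph_nat, rmorphD, rmorphN, rmorphM) /= phiX phiY.
  by ring.
have L1 c : c \in L -> c.1`_0 = 1.
  move=> /mapP [c' /flatten_mapP [q' _ c'q'] ->] /=.
  move: c'q'; rewrite !inE => /or4P [] /eqP -> /=;
   rewrite ?rmorphM /= ?phiX ?phiY ?rmorph1 -horner_coef0 !hornerE //=; ring.
have ab : exists c, (c, parity_part a b q) \in Lq q.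
  case: a; case: b; [exists ('Y * 'X)|exists 'Y|exists 'X|exists 1];
  by rewrite !inE eqxx ?orbT.
have [c hc] := ab.
have [|g] := sos_divXn L1 LE (c := (phi c, phi (parity_part a b q))); last by exists g.
by apply/mapP; exists (c, parity_part a b q) => //; apply/flatten_mapP; exists q.
Qed.

End Node.

(** * The rational parametrization of the nodal cubic *)

Section Curve.
Local Open Scope ring_scope.
Variable R : realType.
Implicit Types (q r : {poly {poly R}}) (x y : R).

(** The parametrization of the nodal cubic by the slope of lines through the
node: it is the point of the line 1 - s = (Y - 1) / (X - 1) other than the
node. *)
Definition curveX x : R := x ^+ 2 / (x - 1).
Definition curveY x : R := x * (1 - x).
(** Its roots, both complex, are the two parameters of the node. *)
Definition node_poly : {poly R} := 'X^2 - 'X + 1.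

(** On the curve, X^i Y^j is s^(2 i + j) (s - 1)^(j - i) up to sign, so bounds on
the support of r bound the order of its pullback at s = 0, at s = 1 and at
infinity. *)
Lemma curve_pullback r z p D :
    (forall i j, r`_j`_i != 0 ->
       [/\ (z <= 2 * i + j)%N, (i <= j + p)%N &
           (2 * i + j - z + (j + p - i) < D)%N]) ->
  exists2 H : {poly R}, (size H <= D)%N &
    forall x, x != 1 ->
      (x - 1) ^+ p * ev2 (curveY x) (curveX x) r = x ^+ z * H.[x].
Proof.
move=> supp.
exists (\sum_(j < size r) \sum_(i < size r`_j)
   (r`_j`_i * (-1) ^+ j) *: ('X^(2 * i + j - z) * ('X - 1%:P) ^+ (j + p - i))).
  apply: (leq_trans (size_sum _ _ _)); apply/bigmax_leqP => j _.
  apply: (leq_trans (size_sum _ _ _)); apply/bigmax_leqP => i _.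
  have [->|/supp [_ _ lt]] := eqVneq r`_j`_i 0; first by rewrite mul0r scale0r size_poly0.
  apply: (leq_trans (size_scale_leq _ _)); apply: leq_trans lt.
  apply: (leq_trans (size_polyMleq _ _)).
  by rewrite size_polyXn size_exp_XsubC addSn addnS.
move=> x x1; have u0 : x - 1 != 0 by rewrite subr_eq0.
rewrite /ev2 (horner_coef r) horner_sum [in RHS]horner_sum !big_distrr /=.
apply: eq_bigr => j _; rewrite hornerM (horner_coef r`_j) [in RHS]horner_sum.
rewrite big_distrl !big_distrr /=; apply: eq_bigr => i _.
rewrite !(hornerZ, hornerM, horner_exp, hornerX, hornerC, hornerXsubC).
have [->|/supp [lez lep _]] := eqVneq r`_j`_i 0; first by rewrite !(mul0r, mulr0).
have yE : curveY x = -1 * (x * (x - 1)) by rewrite /curveY; ring.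
rewrite /curveX yE !exprMn exprVn.
have e1 : x ^+ i * x ^+ i * x ^+ j = x ^+ z * x ^+ (2 * i + j - z).
  by rewrite -!exprD subnKC // addnn mul2n.
have e2 : (x - 1) ^+ p * (x - 1) ^+ j = (x - 1) ^+ (j + p - i) * (x - 1) ^+ i.
  by rewrite -!exprD subnK // addnC.
have v0 : (x - 1) ^+ i != 0 by rewrite expf_neq0.
transitivity (r`_j`_i * (-1) ^+ j * (x ^+ i * x ^+ i * x ^+ j) *
   ((x - 1) ^+ p * (x - 1) ^+ j / (x - 1) ^+ i)); first by ring.
by rewrite e1 e2 mulfK //; ring.
Qed.

Lemma node_polyE x : node_poly.[x] = x ^+ 2 - x + 1.
Proof. by rewrite /node_poly !hornerE. Qed.

(** The pair (t, w) = ((s^2 - s + 1) / (s - 1), 1 - s) is the parametrization of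
the curve in the coordinates of the blow-up. *)
Lemma clear_denominators (F : {poly {poly R}}) :
  exists N (H : {poly R}), forall x, x != 1 ->
    (x - 1) ^+ N * ev2 ((x ^+ 2 - x + 1) / (x - 1)) (1 - x) F = H.[x].
Proof.
elim/poly_ind: F => [|F c [N [H HE]]].
  by exists 0%N, 0 => x _; rewrite /ev2 !horner0 mulr0.
exists N.+1, (H * node_poly + ('X - 1%:P) ^+ N.+1 * (c \Po (1 - 'X))) => x x1.
have u0 : x - 1 != 0 by rewrite subr_eq0.
have -> : (H * node_poly + ('X - 1%:P) ^+ N.+1 * (c \Po (1 - 'X))).[x] =
    H.[x] * (x ^+ 2 - x + 1) + (x - 1) ^+ N.+1 * c.[1 - x].
  rewrite hornerD hornerM node_polyE hornerM horner_exp hornerXsubC horner_comp.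
  by rewrite !(hornerD, hornerN, hornerX, hornerC).
rewrite -HE // ev2D ev2M ev2X ev2C mulrDr; congr (_ + _).
by rewrite exprS; field.
Qed.

Lemma size_node_polyXn k : size (node_poly ^+ k) = (2 * k).+1.
Proof.
have st : size node_poly = 3%N.
  rewrite /node_poly -addrA size_polyDl size_polyXn // (leq_ltn_trans (size_polyD _ _)) //.
  by rewrite size_polyN size_polyX size_poly1.
have n0 : node_poly != 0 by rewrite -size_poly_eq0 st.
by rewrite -[LHS]prednK ?size_poly_gt0 ?expf_neq0 // size_exp st.
Qed.

(** Vanishing to order k at the node makes the k-th power of [node_poly], of
degree 2 k, divide the pullback of r; it is coprime to the factors s and s - 1,
and the remaining factor H has degree less than 2 k, so H = 0. *)
Lemma curve_vanish k r z p (phi : {rmorphism {poly {poly R}} -> {poly {poly R}}}) h :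
    (forall x y r, ev2 x y (phi r) = ev2 (ev2 x y (1 + 'Y * 'X)) (ev2 x y (1 + 'X)) r) ->
    phi r = h * 'X^k ->
    (forall i j, r`_j`_i != 0 ->
       [/\ (z <= 2 * i + j)%N, (i <= j + p)%N &
           (2 * i + j - z + (j + p - i) < 2 * k)%N]) ->
  forall x, x != 1 -> ev2 (curveY x) (curveX x) r = 0.
Proof.
move=> phiE rh supp; have [H sH HE] := curve_pullback supp.
have [N [K KE]] := clear_denominators h.
have key : ('X - 1%:P) ^+ (N + k).+1 * 'X^z * H = ('X - 1%:P) ^+ p.+1 * K * node_poly ^+ k.
  apply: poly_ext => x; rewrite !(hornerM, horner_exp, hornerX, hornerXsubC) node_polyE.
  have [->|x1] := eqVneq x 1; first by rewrite subrr !exprS !mul0r.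
  have u0 : x - 1 != 0 by rewrite subr_eq0.
  rewrite -KE // -mulrA -HE //.
  have := phiE ((x ^+ 2 - x + 1) / (x - 1)) (1 - x) r.
  have -> : ev2 ((x ^+ 2 - x + 1) / (x - 1)) (1 - x) (1 + 'Y * 'X) = curveY x.
    by rewrite ev2D ev2_1 ev2M ev2C ev2X hornerX /curveY; field.
  have -> : ev2 ((x ^+ 2 - x + 1) / (x - 1)) (1 - x) (1 + 'X) = curveX x.
    by rewrite ev2D ev2_1 ev2X /curveX; field.
  rewrite rh ev2M => <-; rewrite /ev2 hornerXn !horner_exp hornerC !exprMn exprVn.
  rewrite (exprS _ (N + k)) (exprS _ p) exprD.
  have v0 : (x - 1) ^+ k != 0 by rewrite expf_neq0.
  by field.
have cop0 : coprimep (node_poly ^+ k) 'X^z.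
  apply/coprimep_expl/coprimep_expr; rewrite -[X in coprimep _ X]subr0 coprimep_XsubC.
  by rewrite /root /node_poly !hornerE expr0n /= subr0 add0r oner_eq0.
have cop1 : coprimep (node_poly ^+ k) (('X - 1%:P) ^+ (N + k).+1).
  apply/coprimep_expl/coprimep_expr; rewrite coprimep_XsubC.
  by rewrite /root /node_poly !hornerE expr1n subrr add0r oner_eq0.
have dv : node_poly ^+ k %| H.
  by rewrite -(Gauss_dvdpr _ cop0) -(Gauss_dvdpr _ cop1) mulrA key dvdp_mull.
have H0 : H = 0.
  apply/eqP/negPn/negP => Hn0; have := dvdp_leq Hn0 dv.
  by rewrite size_node_polyXn leqNgt ltnS sH.
move=> x x1; have u0 : x - 1 != 0 by rewrite subr_eq0.
have := HE x x1; rewrite H0 horner0 mulr0 => /eqP.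
by rewrite mulf_eq0 expf_eq0 (negbTE u0) andbF /= => /eqP.
Qed.

Lemma nodal_cubic_monicE : nodal_cubic R = 'X^2 + (('X^2 - 3%:R * 'X)%:P * 'X + 'X%:P).
Proof. by rewrite /nodal_cubic !(rmorphXn, rmorph_nat, rmorphB, rmorphM) /=; ring. Qed.

Definition nodal_cubic_tail : {poly {poly R}} := ('X^2 - 3%:R * 'X)%:P * 'X + 'X%:P.

Lemma size_nodal_cubic_tail : (size nodal_cubic_tail < size ('X^2 : {poly {poly R}})%R)%N.
Proof.
rewrite /nodal_cubic_tail size_polyXn size_MXaddC; case: ifP => // _.
by rewrite ltnS; exact: size_polyC_leq1.
Qed.

Lemma nodal_cubic_monic : nodal_cubic R \is monic.
Proof.
by rewrite nodal_cubic_monicE monicE lead_coefDl ?size_nodal_cubic_tail // lead_coefXn.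
Qed.

Lemma size_nodal_cubic : size (nodal_cubic R) = 3%N.
Proof. by rewrite nodal_cubic_monicE size_polyDl ?size_nodal_cubic_tail // size_polyXn. Qed.

Lemma ev2_nodal_cubic x y : ev2 y x (nodal_cubic R) = y ^+ 2 + (x ^+ 2 - 3 * x) * y + x.
Proof.
by rewrite /nodal_cubic !ev2E; ring.
Qed.

(** Divide by m, which is monic of degree 2 in Y. The remainder c1 Y + c0 has
coefficients in R[X]; for X >= 5 the curve has two real points above X, with
distinct Y, namely those whose parameters are the roots of s^2 - X s + X. Hence
c1 and c0 vanish at all X >= 5. *)
Lemma nodal_cubic_dvd r : (forall x, x != 1 -> ev2 (curveY x) (curveX x) r = 0) ->
  exists r', r = nodal_cubic R * r'.
Proof.
move=> r0.
have rE := Pdiv.RingMonic.rdivp_eq nodal_cubic_monic r.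
set g := Pdiv.CommonRing.rdivp r (nodal_cubic R) in rE.
set rm := Pdiv.CommonRing.rmodp r (nodal_cubic R) in rE.
have srm : (size rm <= 2)%N.
  have := Pdiv.CommonRing.ltn_rmodpN0 r (monic_neq0 nodal_cubic_monic).
  by rewrite size_nodal_cubic ltnS.
clearbody rm g; suff rm0 : rm = 0 by exists g; rewrite {1}rE rm0 addr0 mulrC.
have rmE : rm = rm`_1 *: 'X + (rm`_0)%:P.
  apply/polyP => i; rewrite coefD coefZ coefX coefC.
  case: i => [|[|i]] /=; rewrite ?mulr0 ?mulr1 ?add0r ?addr0 //.
  by rewrite nth_default // (leq_trans srm).
set c1 := rm`_1 in rmE; set c0 := rm`_0 in rmE; clearbody c1 c0.
have rmx x y : ev2 y x rm = c1.[x] * y + c0.[x].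
  by rewrite {1}rmE ev2D -mul_polyC ev2M !ev2C ev2X.
have zero (x : R) : 5 <= x -> c1.[x] = 0 /\ c0.[x] = 0.
  move=> x5; pose d := Num.sqrt (x ^+ 2 - 4 * x).
  have d0 : 0 < x ^+ 2 - 4 * x by nra.
  have d2 : d ^+ 2 = x ^+ 2 - 4 * x by rewrite sqr_sqrtr // ltW.
  have dn0 : d != 0 by rewrite gt_eqF // sqrtr_gt0.
  have at_root (s : R) : s ^+ 2 - x * s + x = 0 -> c1.[x] * (s * (1 - s)) + c0.[x] = 0.
    move=> sx; have s1 : s != 1 by apply/eqP => s1; move: sx; rewrite s1; nra.
    have u0 : s - 1 != 0 by rewrite subr_eq0.
    have xE : x = curveX s.
      apply: (mulIf u0); rewrite /curveX divfK //; nra.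
    rewrite -rmx -[s * (1 - s)]/(curveY s) xE; have := r0 s s1; rewrite rE ev2D ev2M.
    rewrite ev2_nodal_cubic -xE.
    have -> : curveY s ^+ 2 + (x ^+ 2 - 3 * x) * curveY s + x = 0.
      have : (s ^+ 2 - x * s + x) * (s ^+ 2 + (x - 2) * s + 1) = 0 by rewrite sx mul0r.
      by rewrite /curveY => <-; ring.
    by rewrite mulr0 add0r.
  pose s1 := (x + d) / 2; pose s2 := (x - d) / 2.
  have h1 : c1.[x] * (s1 * (1 - s1)) + c0.[x] = 0 by apply: at_root; rewrite /s1; nra.
  have h2 : c1.[x] * (s2 * (1 - s2)) + c0.[x] = 0 by apply: at_root; rewrite /s2; nra.
  have a0 : c1.[x] = 0.
    have : c1.[x] * (d * (1 - x)) = 0.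
      have -> : d * (1 - x) = s1 * (1 - s1) - s2 * (1 - s2) by rewrite /s1 /s2; field.
      by rewrite mulrBr; lra.
    move=> /eqP; rewrite mulf_eq0 => /orP [/eqP //|].
    by rewrite mulf_eq0 (negbTE dn0) /= subr_eq0 => /eqP x1; lra.
  by split => //; move: h1; rewrite a0 mul0r add0r.
have zp (e : {poly R}) : (forall x, 5 <= x -> e.[x] = 0) -> e = 0.
  move=> e0; have e5 : e \Po ('X + 5%:P) = 0.
    apply: poly_nat_roots => n; rewrite horner_comp hornerD hornerX hornerC; apply: e0.
    by have := ler0n R n; lra.
  apply: poly_ext => x; rewrite horner0 -[x](subrK 5).
  by have := congr1 (horner^~ (x - 5)) e5; rewrite horner_comp hornerD hornerX hornerC horner0.
have c10 : c1 = 0 by apply: zp => x /zero [].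
have c00 : c0 = 0 by apply: zp => x /zero [].
by rewrite rmE c10 c00 scale0r addr0.
Qed.

(** Every q is divisible by S because its parity parts are divisible by m. *)
Lemma choi_lam_sos_descent k (s : seq {poly {poly R}}) : (0 < k)%N ->
    choi_lam R ^+ k = \sum_(q <- s) q ^+ 2 ->
  exists s' : seq {poly {poly R}}, choi_lam R ^+ k = choi_lam R ^+ 2 * \sum_(q <- s') q ^+ 2.
Proof.
move=> k0 SE.
have [phi [phiX phiY phiE]] := bivariate_subst (1 + 'Y * 'X : {poly {poly R}}) (1 + 'X).
have /choice [g gE] : forall q, exists q', q \in s -> q = choi_lam R * q'.
  move=> q; have [qs|_] := boolP (q \in s); last by exists 0.
  have [|q' qE] := @choi_lam_dvd_of_parts R q; last by exists q'.
  move=> a b; apply: nodal_cubic_dvd.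
  have [h hE] := parity_part_node_vanish phiX phiY SE a b qs.
  (* z and p are the bounds of choi_lam_sos_newton, in terms of the exponents
     (i, j) of the parity part, rounded to integers *)
  apply: (curve_vanish (z := (2 * k + 1 - 2 * a - b)./2)
    (p := (k + b - a)./2) phiE hE) => i j.
  rewrite coef_parity_part => /(choi_lam_sos_newton SE qs) [].
  by case: a b {hE} => -[] /=; split; lia.
exists [seq g q | q <- s]; rewrite SE big_distrr big_map /=.
by apply: eq_big_seq => q qs; rewrite {1}(gE q qs) exprMn.
Qed.

Lemma choi_lam_at11 : ev2 1 1 (choi_lam R) = 0.
Proof.
by rewrite /choi_lam !ev2E; ring.
Qed.

Lemma choi_lam_neq0 : choi_lam R != 0.
Proof.
apply/eqP => S0; have : ev2 1 0 (choi_lam R) = 0 by rewrite S0 /ev2 !horner0.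
rewrite /choi_lam !ev2E => /eqP.
by rewrite !expr0n /= !(mulr0, mul0r, add0r, subr0) expr1n oner_eq0.
Qed.

Lemma choi_lam_power_not_sos k (s : seq {poly {poly R}}) : odd k ->
  choi_lam R ^+ k <> \sum_(q <- s) q ^+ 2.
Proof.
move=> ok; have -> : k = (k./2).*2.+1 by rewrite -[LHS]odd_double_half ok.
elim: (k./2) s => [|n IH] s /choi_lam_sos_descent [] // s'.
  rewrite expr1 expr2 -mulrA -[LHS]mulr1 => /(mulfI choi_lam_neq0) /(congr1 (ev2 1 1)).
  by rewrite ev2_1 ev2M choi_lam_at11 mul0r => /eqP; rewrite oner_eq0.
rewrite doubleS -[(n.*2.+2.+1)%N]/(2 + n.*2.+1)%N exprD => /(mulfI _) e.
by apply: (IH s'); apply: e; rewrite expf_neq0 // choi_lam_neq0.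
Qed.

End Curve.

(** * Stubborn forms *)

Section Assembly.
Local Open Scope ring_scope.
Variable R : realType.

(** A substitution of polynomials that turns P into S turns a decomposition of
P^k into one of S^k. *)
Lemma stubborn_of_subst n d (P : {mpoly R[n]}) (h : 'I_n -> {poly {poly R}}) :
    nonneg_forms R n d P ->
    mmap (@polyC {poly R} \o @polyC R) h P = choi_lam R ->
  stubborn R n d P.
Proof.
move=> nnP hP; split => // k ok [_ [s _ PE]].
apply: (@choi_lam_power_not_sos R k [seq mmap (@polyC {poly R} \o @polyC R) h q | q <- s] ok).
rewrite -hP -rmorphXn PE rmorph_sum big_map; apply: eq_bigr => q _.
by rewrite rmorphXn.
Qed.

(** If the middle variable y is the largest one, the difference is
y (x - z)^2 + z (y - x) (y - z); the cyclic symmetry covers the other cases. *)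
Lemma cyclic_amgm3 (a b c : R) : 0 <= a -> 0 <= b -> 0 <= c ->
  0 <= a ^+ 2 * b + b ^+ 2 * c + c ^+ 2 * a - 3 * (a * b * c).
Proof.
pose E (x y z : R) := x ^+ 2 * y + y ^+ 2 * z + z ^+ 2 * x - 3 * (x * y * z).
have H (x y z : R) : 0 <= x -> 0 <= y -> 0 <= z -> x <= y -> z <= y -> 0 <= E x y z.
  move=> x0 y0 z0 xy zy.
  have -> : E x y z = y * (x - z) ^+ 2 + z * ((y - x) * (y - z)) by rewrite /E; ring.
  by rewrite addr_ge0 // mulr_ge0 ?sqr_ge0 // mulr_ge0 // subr_ge0.
have cyc x y z : E x y z = E y z x by rewrite /E; ring.
move=> a0 b0 c0; rewrite -/(E a b c).
have [ab|/ltW ba] := lerP a b; have [cb|/ltW bc] := lerP c b.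
- exact: H.
- by rewrite cyc; apply: H => //; exact: le_trans ab bc.
- by rewrite -cyc; apply: H => //; exact: le_trans cb ba.
- have [ac|/ltW ca] := lerP a c; first by rewrite cyc; exact: H.
  by rewrite -cyc; exact: H.
Qed.

(** Written as a sum of nonnegative terms in two ways, according to the sign of
x y. *)
Lemma choi_lam_quartic_ge0 (x y z w : R) :
  0 <= x ^+ 2 * y ^+ 2 + x ^+ 2 * z ^+ 2 + y ^+ 2 * z ^+ 2 + w ^+ 4 - 4 * (x * y * z * w).
Proof.
set Q := (X in 0 <= X); have [xy|/ltW xy] := lerP 0 (x * y).
  have -> : Q = (x * y - w ^+ 2) ^+ 2 + z ^+ 2 * (x - y) ^+ 2
      + 2 * (x * y * (w - z) ^+ 2) by rewrite /Q; ring.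
  apply: addr_ge0; last by apply: mulr_ge0 => //; apply: mulr_ge0 => //; exact: sqr_ge0.
  by apply: addr_ge0; [exact: sqr_ge0|apply: mulr_ge0; exact: sqr_ge0].
have -> : Q = (x * y + w ^+ 2) ^+ 2 + z ^+ 2 * (x + y) ^+ 2
    + 2 * (- (x * y) * (w + z) ^+ 2) by rewrite /Q; ring.
apply: addr_ge0; first by apply: addr_ge0; [exact: sqr_ge0|apply: mulr_ge0; exact: sqr_ge0].
by apply: mulr_ge0 => //; apply: mulr_ge0; [rewrite oppr_ge0|exact: sqr_ge0].
Qed.

Lemma dhomog_var n (i : 'I_n) k : ('X_i ^+ k : {mpoly R[n]}) \is k.-homog.
Proof. by rewrite -[k in k.-homog]mul1n; apply: dhomogMn; rewrite dhomogX /= mdeg1. Qed.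

(** The Choi-Lam sextic x^4 y^2 + y^4 z^2 + z^4 x^2 - 3 x^2 y^2 z^2, multiplied
by an even power of the variable z that the substitution sends to 1. *)
Lemma stubborn_sextic n d : (3 <= n)%N -> (6 <= d)%N -> ~~ odd d ->
  exists P, stubborn R n d P.
Proof.
case: n => [|[|[|n]]] // _ d6 evd.
pose z : 'I_n.+3 := ord0; pose x : 'I_n.+3 := @Ordinal n.+3 1 isT.
pose y : 'I_n.+3 := @Ordinal n.+3 2 isT.
pose P : {mpoly R[n.+3]} := 'X_z ^+ (d - 6) * ('X_x ^+ 4 * 'X_y ^+ 2 + 'X_y ^+ 4 * 'X_z ^+ 2
  + 'X_z ^+ 4 * 'X_x ^+ 2 - 3%:R * ('X_x ^+ 2 * 'X_y ^+ 2 * 'X_z ^+ 2)).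
exists P; apply: (stubborn_of_subst (h := fun i => nth 0 [:: 1; 'X; 'Y] i)).
  split => /=.
    rewrite -(subnK d6); apply: dhomogM; first exact: dhomog_var.
    have hM i j a b : ('X_i ^+ a * 'X_j ^+ b : {mpoly R[n.+3]}) \is (a + b).-homog.
      by apply: dhomogM; exact: dhomog_var.
    rewrite mulr_natl; apply: rpredB; last apply: rpredMn.
      by apply: rpredD; [apply: rpredD; exact: (hM _ _ 4 2)|exact: (hM _ _ 4 2)].
    exact: (dhomogM (hM _ _ 2 2) (dhomog_var _ 2)).
  move=> v; rewrite /P !(rmorphXn, rmorph_nat, rmorphD, rmorphN, rmorphM) /= !mevalXU.
  apply: mulr_ge0; first by rewrite exprn_even_ge0 // oddB // addbF.
  have := cyclic_amgm3 (sqr_ge0 (v x)) (sqr_ge0 (v y)) (sqr_ge0 (v z)).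
  by congr (0 <= _); ring.
rewrite /P !(rmorphXn, rmorph_nat, rmorphD, rmorphN, rmorphM) /=.
by rewrite !mmapX !mmap1U /= /choi_lam expr1n; ring.
Qed.

(** The Choi-Lam quartic in z, x, y, w, which becomes S at (1, x y, x, y). *)
Lemma stubborn_quartic n d : (4 <= n)%N -> (4 <= d)%N -> ~~ odd d ->
  exists P, stubborn R n d P.
Proof.
case: n => [|[|[|[|n]]]] // _ d4 evd.
pose z : 'I_n.+4 := ord0; pose x : 'I_n.+4 := @Ordinal n.+4 1 isT.
pose y : 'I_n.+4 := @Ordinal n.+4 2 isT; pose w : 'I_n.+4 := @Ordinal n.+4 3 isT.
pose P : {mpoly R[n.+4]} := 'X_z ^+ (d - 4) * ('X_x ^+ 2 * 'X_y ^+ 2 + 'X_x ^+ 2 * 'X_z ^+ 2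
  + 'X_y ^+ 2 * 'X_z ^+ 2 + 'X_w ^+ 4 - 4%:R * ('X_x * 'X_y * 'X_z * 'X_w)).
exists P; apply: (stubborn_of_subst (h := fun i => nth 0 [:: 1; 'X * 'Y; 'X; 'Y] i)).
  split => /=.
    rewrite -(subnK d4); apply: dhomogM; first exact: dhomog_var.
    have hM i j : ('X_i ^+ 2 * 'X_j ^+ 2 : {mpoly R[n.+4]}) \is 4.-homog.
      by apply: (@dhomogM _ _ _ 2 _ 2); exact: dhomog_var.
    have h1 i : ('X_i : {mpoly R[n.+4]}) \is 1.-homog by exact: (dhomog_var i 1).
    rewrite mulr_natl; apply: rpredB; last apply: rpredMn.
      apply: rpredD; last exact: dhomog_var.
      by apply: rpredD; [apply: rpredD; exact: hM|exact: hM].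
    exact: (dhomogM (dhomogM (dhomogM (h1 _) (h1 _)) (h1 _)) (h1 _)).
  move=> v; rewrite /P !(rmorphXn, rmorph_nat, rmorphD, rmorphN, rmorphM) /= !mevalXU.
  apply: mulr_ge0; first by rewrite exprn_even_ge0 // oddB // addbF.
  exact: choi_lam_quartic_ge0.
rewrite /P !(rmorphXn, rmorph_nat, rmorphD, rmorphN, rmorphM) /=.
by rewrite !mmapX !mmap1U /= /choi_lam expr1n; ring.
Qed.

Lemma sos_forms_of_sos n d (P : {mpoly R[n]}) : P \is d.-homog ->
  sos (hform d./2) (fun v => P.@[v]) -> sos_forms R n d P.
Proof.
move=> hP /sos_mpoly [s hs sE]; split => //; exists s => //.
by apply: mpoly_ext => v; rewrite sE.
Qed.

Lemma stubborn_Delta n d P : stubborn R n d P -> Delta R n d P.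
Proof.
move=> [nnP sP]; split => // sosP; apply: (sP 1%N isT).
by rewrite muln1 expr1.
Qed.

(** Hilbert's theorem: the excluded pairs (n, d) are those with n <= 2, those with
d = 2, and (3, 4). *)
Lemma Delta_neq0 n d : (0 < n)%N -> (0 < d)%N -> ~~ odd d -> Delta R n d !=set0 ->
  (3 <= n /\ 6 <= d)%N \/ (4 <= n /\ 4 <= d)%N.
Proof.
move=> n0 d0 evd [P [[hP Pge0] nsos]]; apply: contrapT => small; apply: nsos.
apply: sos_forms_of_sos => //.
have dE : d = d./2.*2 by rewrite -[LHS]odd_double_half (negbTE evd).
have fP : hform d./2.*2 (fun v => P.@[v]) by rewrite -dE; exists P.
have [n1|n1] := eqVneq n 1%N; first by subst n; exact: unary_sos.
have [n2|n2] := eqVneq n 2%N; first by subst n; exact: binary_sos.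
have [d2|d2] := eqVneq d 2%N; first by subst d; exact: quadratic_form_sos.
have [d4 n3] : d = 4%N /\ n = 3%N by lia.
by subst d n; exact: ternary_quartic_sos.
Qed.

End Assembly.

Theorem theorem40 (R : realType) (n d : nat)
    (n_gt0 : 0 < n) (d_gt0 : 0 < d) (d_even : ~~ odd d) :
  (Delta R n d !=set0 <-> (3 <= n /\ 6 <= d) \/ (4 <= n /\ 4 <= d)) /\
  (Delta R n d !=set0 -> exists P, nonneg_forms R n d P /\ stubborn R n d P).
Proof.
have ex : (3 <= n /\ 6 <= d) \/ (4 <= n /\ 4 <= d) -> exists P, stubborn R n d P.
  by case=> -[hn hd]; [exact: stubborn_sextic|exact: stubborn_quartic].
have lr := Delta_neq0 n_gt0 d_gt0 d_even.
split; last by move=> /lr /ex [P sP]; exists P; split => //; case: sP.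
by split => [/lr|/ex [P /stubborn_Delta DP]] //; exists P.
Qed.
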